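(* There exists a reduced quasiconformal mapping $f\colon\mathbb{C}\to\mathbb{C}$ whose restriction to the segment $[0,1]$ has infinite $\Phi_q$-variation for every $0<q<1$, i.e. $\sup\sum_{j=1}^N\Phi_q(|f(x_j)-f(x_{j-1})|)=\infty$, the supremum over all $N\ge1$ and all partitions $0=x_0<\dots<x_N=1$.
   Context: A nonconstant continuous mapping $f\colon\mathbb{C}\to\mathbb{C}$ in $W^{1,2}_{\rm loc}$ is reduced quasiconformal if there is a constant $k\in[0,1)$ with $|f_{\bar z}|\le k\operatorname{Re} f_z$ almost everywhere. For $q>0$, $\Phi_q\colon[0,\infty)\to[0,\infty)$ denotes any convex increasing function with $\Phi_q(t)=t/(\log(1/t))^q$ for all sufficiently small $t>0$. A function $v$ on $[a,b]$ has finite $\Phi$-variation if $\sup\sum_{j=1}^N\Phi(|v(x_j)-v(x_{j-1})|)<\infty$ over all partitions $a=x_0<\dots<x_N=b$, $N\ge1$. *)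

(* Defs.v *)
(* The complex plane C is modelled as R * R
   (z = x + i y  <->  (x, y)), with R : realType. *)
From mathcomp Require Import all_boot all_order all_algebra.
From mathcomp Require Import all_classical all_reals all_analysis.
Import Order.TTheory GRing.Theory Num.Theory.
Import numFieldNormedType.Exports.

Set Implicit Arguments.
Unset Strict Implicit.
Unset Printing Implicit Defensive.

Local Open Scope classical_set_scope.
Local Open Scope ring_scope.

Section Defs.
Variable R : realType.

Definition leb2 := (@lebesgue_measure R \x @lebesgue_measure R)%E.

Fixpoint iter_D (vs : seq (R * R)) (phi : R * R -> R) : R * R -> R :=
  match vs with
  | [::] => phi
  | v :: vs' => 'D_v (iter_D vs' phi)
  end.

Definition smooth2 (phi : R * R -> R) : Prop :=
  forall (vs : seq (R * R)) (z : R * R), differentiable (iter_D vs phi) z.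

Definition test_fun (phi : R * R -> R) : Prop :=
  smooth2 phi /\
  exists K : set (R * R), compact K /\ forall z, ~ K z -> phi z = 0.

Definition weak_deriv (e : R * R) (u g : R * R -> R) : Prop :=
  forall phi, test_fun phi ->
    (\int[leb2]_z (u z * 'D_e phi z)%:E = - \int[leb2]_z (g z * phi z)%:E)%E.

Definition L2loc (u : R * R -> R) : Prop :=
  forall K : set (R * R), compact K ->
    measurable_fun K u /\ leb2.-integrable K (fun z => (u z ^+ 2)%:E).

Definition ex := ((1 : R), (0 : R)).
Definition ey := ((0 : R), (1 : R)).

Definition W12loc_with (f : R * R -> R * R) (ux uy vx vy : R * R -> R) : Prop :=
  [/\ L2loc (fun z => (f z).1), L2loc (fun z => (f z).2),
      [/\ L2loc ux, L2loc uy, L2loc vx & L2loc vy] &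
      [/\ weak_deriv ex (fun z => (f z).1) ux,
          weak_deriv ey (fun z => (f z).1) uy,
          weak_deriv ex (fun z => (f z).2) vx &
          weak_deriv ey (fun z => (f z).2) vy]].

(* With f_z = (f_x - i f_y)/2 and f_zbar = (f_x + i f_y)/2:
   Re f_z = (u_x + v_y)/2,
   |f_zbar| = sqrt((u_x - v_y)^2 + (v_x + u_y)^2)/2. *)
Definition re_fz (ux uy vx vy : R * R -> R) (z : R * R) : R :=
  (ux z + vy z) / 2.
Definition abs_fzbar (ux uy vx vy : R * R -> R) (z : R * R) : R :=
  Num.sqrt ((ux z - vy z) ^+ 2 + (vx z + uy z) ^+ 2) / 2.

Definition reduced_qc (f : R * R -> R * R) : Prop :=
  (exists z w, f z <> f w) /\ continuous f /\
  exists ux uy vx vy, W12loc_with f ux uy vx vy /\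
    exists k : R, 0 <= k < 1 /\
      {ae leb2, forall z, abs_fzbar ux uy vx vy z <= k * re_fz ux uy vx vy z}.

Definition cmod (z : R * R) : R := Num.sqrt (z.1 ^+ 2 + z.2 ^+ 2).
Definition cdiff (z w : R * R) : R * R := (z.1 - w.1, z.2 - w.2).

Definition Phi_q (q : R) (Phi : R -> R) : Prop :=
  [/\ (forall t, 0 <= t -> 0 <= Phi t),
      (forall s t, 0 <= s -> s < t -> Phi s < Phi t),
      (forall s t l, 0 <= s -> 0 <= t -> 0 <= l <= 1 ->
         Phi (l * s + (1 - l) * t) <= l * Phi s + (1 - l) * Phi t) &
      exists delta : R, 0 < delta /\
        forall t, 0 < t < delta -> Phi t = t / (ln (t^-1)) `^ q].

Definition partition01 (N : nat) (x : nat -> R) : Prop :=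
  (0 < N)%N /\ x 0%N = 0 /\ x N = 1 /\ forall j, (j < N)%N -> x j < x j.+1.

Definition Phi_sum (Phi : R -> R) (g : R -> R * R) (N : nat) (x : nat -> R) : R :=
  \sum_(0 <= j < N) Phi (cmod (cdiff (g (x j.+1)) (g (x j)))).

Definition infinite_Phi_variation01 (Phi : R -> R) (g : R -> R * R) : Prop :=
  forall M : R, exists N x, partition01 N x /\ M < Phi_sum Phi g N x.

End Defs.

(* Main.v *)
(* On the line let [om_n = 2 pi b^n], [F_0 = id] and
   [F_(n+1) = F_n + (eps / om_n) u_n' e^(i om_n x)], [F_n = u_n + i v_n].  Each
   step multiplies [u_n'] by a factor close to [1], so [u_n' > 0], while the slope
   [v_n' / u_n'] performs a random-walk-like motion.  Hence
   [sum_j |v((j+1)/b^n) - v(j/b^n)|] grows at least linearly in [n] on the [b]-adic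
   grid, which Jensen's inequality turns into a [Phi_q]-sum of order at least
   [n / (n log b)^q].  In the plane every increment [D] of [F] is replaced by
   [D(x) + i y D'(x)], cut off at height [|y| ~ 1 / om_n].  At height [y] only one
   cut-off is active; the coarser terms add up to a nearly holomorphic map whose
   derivative has real part about [u_m'], and the active one perturbs it by
   [O(eps u_m')].  This gives the reduced Beltrami inequality off the real axis,
   and the gradient, of size [2^n] only on the strips [|y| <= 2 / om_n], is
   locally square integrable. *)

Require Import Defs.
From mathcomp Require Import all_boot all_order all_algebra.
From mathcomp Require Import all_classical all_reals all_analysis.
From mathcomp Require Import measurable_realfun ring lra.
Import Order.TTheory GRing.Theory Num.Theory.
Import numFieldNormedType.Exports.
Set Implicit Arguments.
Unset Strict Implicit.
Unset Printing Implicit Defensive.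
Local Open Scope classical_set_scope.
Local Open Scope ring_scope.

(** The growth of the variation is a second-order effect. Put [d = u_n'], [w = v_n'], [s = w / d].
    One step moves [s] by about [eps * sqrt (1 + s^2) * cos (om x - atan s)], to first order an
    oscillation without mean. A function [beta] with [beta'' = 1 / (1 + s^2)] removes the factor
    [1 + s^2] from the squared jump, so [d * beta s] gains about [eps^2 * d * cos^2] uniformly in
    [s]; as [beta] grows only linearly, the gain must show in [|w|]. The errors come from
    differentiating coefficients of frequency at most [om n / b], so a large [b] makes them small
    against the gain. A small [eps] keeps [d] positive, keeps the expansion of [beta] valid and
    closes the Beltrami inequality. The slope need not stay bounded: [w] enters [U_y] and [V_x] with
    opposite signs, hence cancels in [f_zbar] and only feeds [Im f_z]. Linear growth leaves
    [n^(1 - q)], so one map serves all [q < 1]. *)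

Ltac nneg := first [assumption | apply: ltW; assumption | exact: ler0n | exact: ler01 |
  exact: normr_ge0 | exact: sqr_ge0 | apply: mulr_ge0; nneg | apply: divr_ge0; nneg |
  apply: addr_ge0; nneg].

(** * One-variable calculus *)

Section Calculus.
Variable R : realType.
Implicit Types (f g w : R -> R) (x : R).

Lemma is_deriveDf f g x df dg : is_derive x (1 : R) f df -> is_derive x (1 : R) g dg ->
  is_derive x (1 : R) (fun t => f t + g t) (df + dg).
Proof. by move=> ? ?; exact: is_deriveD. Qed.

Lemma is_deriveBf f g x df dg : is_derive x (1 : R) f df -> is_derive x (1 : R) g dg ->
  is_derive x (1 : R) (fun t => f t - g t) (df - dg).
Proof. by move=> ? ?; exact: is_deriveB. Qed.

Lemma is_deriveMf f g x df dg : is_derive x (1 : R) f df -> is_derive x (1 : R) g dg ->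
  is_derive x (1 : R) (fun t => f t * g t) (f x * dg + df * g x).
Proof. by move=> ? ?; rewrite [df * _]mulrC; exact: is_deriveM. Qed.

Lemma is_deriveCf (c : R) f x df : is_derive x (1 : R) f df ->
  is_derive x (1 : R) (fun t => c * f t) (c * df).
Proof. by move=> ?; exact: is_deriveZ. Qed.

Lemma is_derive_compf f g x df dg : is_derive (g x) (1 : R) f df ->
  is_derive x (1 : R) g dg -> is_derive x (1 : R) (fun t => f (g t)) (df * dg).
Proof. by move=> ? ?; exact: is_derive1_comp. Qed.

Lemma is_derive_linear (c x : R) : is_derive x (1 : R) (fun t => c * t) c.
Proof. by apply: is_derive_eq (is_deriveCf c (is_derive_id _ _)) _; rewrite mulr1. Qed.

Lemma derive1_eq f g : (forall x, is_derive x (1 : R) f (g x)) -> derive1 f = g.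
Proof. by move=> h; apply/funext => x; rewrite derive1E; case: (h x). Qed.

Lemma derivable_is_derive f x : derivable f x 1 -> is_derive x (1 : R) f (derive1 f x).
Proof. by move=> h; apply: DeriveDef => //; rewrite derive1E. Qed.

Lemma is_derive_derivable f x df : is_derive x (1 : R) f df -> derivable f x 1.
Proof. by case. Qed.

(* [|g^(i)| <= lam ^ i w] for all [i <= k].  Taking [g = w = u_n'] with all orders
   at once makes the bound stable under the recursion for [u_n], although each
   step loses one derivative. *)
Fixpoint deriv_bound (k : nat) (lam : R) (w g : R -> R) : Prop :=
  (forall x, `|g x| <= w x) /\
  if k is k'.+1 then
    (forall x, derivable g x 1) /\ deriv_bound k' lam (fun x => lam * w x) (derive1 g)
  else True.

Lemma deriv_bound0 k lam w g : deriv_bound k lam w g -> forall x, `|g x| <= w x.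
Proof. by case: k => [|k] []. Qed.

Lemma deriv_bound_ge0 k lam w g : deriv_bound k lam w g -> forall x, 0 <= w x.
Proof. by move=> /deriv_bound0 h x; exact: le_trans (h x). Qed.

Lemma deriv_boundS k lam w g : deriv_bound k.+1 lam w g -> deriv_bound k lam w g.
Proof.
elim: k w g => [|k IH] w g; first by case.
by move=> [h0 [h1 h2]]; split=> //; split=> //; exact: IH.
Qed.

Lemma deriv_bound_le k lam mu w w' g : 0 <= lam -> lam <= mu -> (forall x, w x <= w' x) ->
  deriv_bound k lam w g -> deriv_bound k mu w' g.
Proof.
move=> l0 lm; elim: k w w' g => [|k IH] w w' g ww' h.
  by split=> // x; exact: le_trans (deriv_bound0 h x) (ww' x).
have w0 := deriv_bound_ge0 h; case: h => h0 [h1 h2].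
split; first by move=> x; exact: le_trans (h0 x) (ww' x).
by split=> //; apply: IH h2 => x; rewrite ler_pM.
Qed.

Lemma deriv_boundD k lam w1 w2 g1 g2 : deriv_bound k lam w1 g1 -> deriv_bound k lam w2 g2 ->
  deriv_bound k lam (fun x => w1 x + w2 x) (fun x => g1 x + g2 x).
Proof.
elim: k w1 w2 g1 g2 => [|k IH] w1 w2 g1 g2.
  by move=> [h _] [h' _]; split=> // x; rewrite (le_trans (ler_normD _ _)) ?lerD.
move=> [h [d1 h1]] [h' [d2 h2]]; split.
  by move=> x; rewrite (le_trans (ler_normD _ _)) ?lerD.
have D x := is_deriveDf (derivable_is_derive (d1 x)) (derivable_is_derive (d2 x)).
split; first by move=> x; exact: is_derive_derivable (D x).
rewrite (derive1_eq D).
have -> : (fun x => lam * (w1 x + w2 x)) = (fun x => lam * w1 x + lam * w2 x).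
  by apply/funext => x; rewrite mulrDr.
exact: IH.
Qed.

Lemma deriv_boundZ k lam (c : R) w g : deriv_bound k lam w g ->
  deriv_bound k lam (fun x => `|c| * w x) (fun x => c * g x).
Proof.
elim: k w g => [|k IH] w g.
  by move=> [h _]; split=> // x; rewrite normrM ler_wpM2l.
move=> [h [d1 h1]]; split; first by move=> x; rewrite normrM ler_wpM2l.
have D x := is_deriveCf c (derivable_is_derive (d1 x)).
split; first by move=> x; exact: is_derive_derivable (D x).
rewrite (derive1_eq D).
have -> : (fun x => lam * (`|c| * w x)) = (fun x => `|c| * (lam * w x)).
  by apply/funext => x; rewrite mulrCA.
exact: IH.
Qed.

(** Rates add under products because the binomial coefficients of Leibniz' rule sum to
    [(lam + mu)^i]. The factor [t] has a constant weight [c], so the weight of the product is again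
    a multiple of [w]. *)
Lemma deriv_boundM k lam mu (c : R) w g t : 0 <= lam -> 0 <= mu ->
  deriv_bound k lam w g -> deriv_bound k mu (cst c) t ->
  deriv_bound k (lam + mu) (fun x => c * w x) (fun x => g x * t x).
Proof.
move=> l0 m0; elim: k c w g t => [|k IH] c w g t.
  by move=> [h _] [h' _]; split=> // x; rewrite normrM mulrC ler_pM.
move=> hg ht; move: (hg) (ht) => [h [d1 h1]] [h' [d2 h2]].
split; first by move=> x; rewrite normrM mulrC ler_pM.
have D x := is_deriveMf (derivable_is_derive (d1 x)) (derivable_is_derive (d2 x)).
split; first by move=> x; exact: is_derive_derivable (D x).
rewrite (derive1_eq D).
have -> : (fun x => (lam + mu) * (c * w x)) =
    (fun x => (mu * c) * w x + c * (lam * w x)).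
  by apply/funext => x; ring.
by apply: deriv_boundD; apply: IH => //; exact: deriv_boundS.
Qed.

Lemma is_derive_cos_lin (a x : R) : is_derive x (1 : R) (fun t => cos (a * t)) (- a * sin (a * x)).
Proof.
apply: is_derive_eq (is_derive_compf (is_derive_cos _) (is_derive_linear a x)) _.
by rewrite mulNr mulrC mulNr.
Qed.

Lemma is_derive_sin_lin (a x : R) : is_derive x (1 : R) (fun t => sin (a * t)) (a * cos (a * x)).
Proof. by rewrite mulrC; exact: is_derive_compf (is_derive_sin _) (is_derive_linear a x). Qed.

Lemma cos_le1n (x : R) : `|cos x| <= 1.
Proof. by rewrite ler_norml cos_le1 cos_geN1. Qed.

Lemma sin_le1n (x : R) : `|sin x| <= 1.
Proof. by rewrite ler_norml sin_le1 sin_geN1. Qed.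

Lemma deriv_bound_trig k (a : R) : 0 <= a ->
  deriv_bound k a (cst 1) (fun x => cos (a * x)) /\
  deriv_bound k a (cst 1) (fun x => sin (a * x)).
Proof.
move=> a0; elim: k => [|k [IHc IHs]].
  by split; split=> // x; [exact: cos_le1n|exact: sin_le1n].
split; (split; first by move=> x; [exact: cos_le1n || exact: sin_le1n]).
- split; first by move=> x; exact: is_derive_derivable (is_derive_cos_lin a x).
  rewrite (derive1_eq (is_derive_cos_lin a)).
  by have := deriv_boundZ (- a) IHs; rewrite normrN (ger0_norm a0).
- split; first by move=> x; exact: is_derive_derivable (is_derive_sin_lin a x).
  rewrite (derive1_eq (is_derive_sin_lin a)).
  by have := deriv_boundZ a IHc; rewrite (ger0_norm a0).
Qed.

Lemma deriv_bound_osc k (a c : R) w g : 0 <= c -> 0 < a -> deriv_bound k a w g ->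
  deriv_bound k (2 * a) (fun x => c * w x) (fun x => c * (g x * cos (a * x))) /\
  deriv_bound k (2 * a) (fun x => c * w x) (fun x => c * (g x * sin (a * x))).
Proof.
move=> c0 a0 hg; have [hc hs] := @deriv_bound_trig k a (ltW a0).
have E t : deriv_bound k a (cst 1) t ->
    deriv_bound k (2 * a) (fun x => c * w x) (fun x => c * (g x * t x)).
  move=> ht; have := deriv_boundZ c (deriv_boundM (ltW a0) (ltW a0) hg ht).
  rewrite ger0_norm// -mulr2n -[a *+ 2]mulr_natl.
  by under eq_fun do rewrite mul1r.
by split; exact: E.
Qed.

(** Covers both orders of [a] and [c]. The sign condition records that [z] lies on the same side of
    [a] as [c]. *)
Lemma MVT_any f (df : R -> R) (a c : R) : (forall x, is_derive x (1 : R) f (df x)) ->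
  exists z, [/\ `|z - a| <= `|c - a|, 0 <= (z - a) * (c - a) & f c - f a = df z * (c - a)].
Proof.
move=> D.
have cf : continuous f.
  by move=> x; apply: differentiable_continuous; apply/derivable1_diffP; case: (D x).
have [ac|ca|ac] := ltgtP a c.
- have [z /[!in_itv]/= /andP[az zc] E] := MVT ac (fun x _ => D x) (continuous_subspaceT cf).
  by exists z; split => //; [rewrite !ger0_norm; lra|apply: mulr_ge0; lra].
- have [z /[!in_itv]/= /andP[cz za] E] := MVT ca (fun x _ => D x) (continuous_subspaceT cf).
  exists z; split => //; [rewrite !ler0_norm; lra|rewrite -mulrNN; apply: mulr_ge0; lra|].
  by rewrite -opprB E -mulrN opprB.
- by rewrite ac; exists c; split; rewrite ?subrr ?mulr0.
Qed.

Lemma mul_le_sumsq (a c : R) : 0 <= a -> 0 <= c -> a * c <= a ^+ 2 + c ^+ 2.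
Proof.
by move=> a0 c0; have := sqr_ge0 (a - c); have := mulr_ge0 a0 c0; rewrite !expr2; lra.
Qed.

Lemma cos_half_sq (t : R) : cos t ^+ 2 = (1 + cos (2 * t)) / 2.
Proof.
rewrite (_ : 2 * t = t + t); last by ring.
by rewrite cosD; have := cos2Dsin2 t; rewrite !expr2; lra.
Qed.

(** Chosen for [beta'' = 1 / (1 + s^2)]: slope jumps are proportional to [sqrt (1 + s^2)], so their
    quadratic gain does not depend on the slope. *)
Definition beta (s : R) : R := s * atan s - ln (1 + s ^+ 2) / 2.

Lemma is_derive_log1sq f x df : is_derive x (1 : R) f df ->
  is_derive x (1 : R) (fun t => ln (1 + f t ^+ 2) / 2) (f x * (df / (1 + f x ^+ 2))).
Proof.
move=> D.
have p : 0 < 1 + f x ^+ 2 by rewrite ltr_wpDr ?sqr_ge0.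
have D2 : is_derive x (1 : R) (fun t => 1 + f t * f t) (0 + (f x * df + df * f x)).
  by apply: is_deriveDf; exact: is_deriveMf.
have D3 : is_derive (1 + f x * f x) (1 : R) (@ln R) (1 + f x * f x)^-1.
  by apply: is_derive1_ln; rewrite -expr2.
have D4 := is_deriveCf (1 / 2) (@is_derive_compf _ (fun t => 1 + f t * f t) _ _ _ D3 D2).
have E : (fun t => ln (1 + f t ^+ 2) / 2) = (fun t => 1 / 2 * ln (1 + f t * f t)).
  by apply/funext => t; rewrite expr2 mulrC mul1r.
by rewrite E; apply: is_derive_eq D4 _; rewrite expr2; field; rewrite -expr2 gt_eqF.
Qed.

Lemma is_derive_atanf f x df : is_derive x (1 : R) f df ->
  is_derive x (1 : R) (fun t => atan (f t)) (df / (1 + f x ^+ 2)).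
Proof.
move=> D; have D1 : is_derive (f x) (1 : R) (@atan R) (1 + f x ^+ 2)^-1 by exact: is_derive1_atan.
by rewrite mulrC; exact: is_derive_compf D1 D.
Qed.

Lemma is_derive_beta x : is_derive x (1 : R) beta (atan x).
Proof.
have D := is_derive_id x (1 : R).
have := is_deriveBf (is_deriveMf D (is_derive_atanf D)) (is_derive_log1sq D).
by move=> /is_derive_eq; apply; ring.
Qed.

(** Convexity with half the curvature at [s]. The derivative of the auxiliary [phi] at [z] is [(z -
    s) * (1 / (1 + y^2) - 1 / (2 * (1 + s^2)))] with [y] between [s] and [z], and the bound on [t]
    keeps [1 + y^2 <= 2 * (1 + s^2)] along the whole segment. *)
Lemma beta_bregman (s t : R) : `|t| <= (1 + `|s|) / 5 ->
  t ^+ 2 / (4 * (1 + s ^+ 2)) <= beta (s + t) - beta s - atan s * t.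
Proof.
move=> ts; set m := (4 * (1 + s ^+ 2))^-1.
have p (r : R) : 0 < 1 + r ^+ 2 by rewrite ltr_wpDr ?sqr_ge0.
pose phi x := beta x - atan s * x - m * ((x - s) * (x - s)).
have Dphi x : is_derive x (1 : R) phi (atan x - atan s - 2 * m * (x - s)).
  have Ds : is_derive x (1 : R) (fun y : R => y - s) 1.
    have h := is_deriveBf (is_derive_id x (1 : R)) (is_derive_cst s x (1 : R)).
    by apply: is_derive_eq h _; rewrite subr0.
  have h := is_deriveBf (is_deriveBf (is_derive_beta x) (is_deriveCf (atan s) (is_derive_id x (1 : R))))
    (is_deriveCf m (is_deriveMf Ds Ds)).
  by apply: is_derive_eq h _; ring.
have [z [zt zpos Ez]] := MVT_any s (s + t) Dphi.
have Datan x : is_derive x (1 : R) (@atan R) (1 + x ^+ 2)^-1 by exact: is_derive1_atan.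
have [y [yz _ Ey]] := MVT_any s z Datan.
rewrite [s + t]addrC addrK in zt zpos Ez.
have sy : 1 + y ^+ 2 <= 2 * (1 + s ^+ 2).
  have : `|y| <= `|s| + (1 + `|s|) / 5.
    have := ler_normD (y - s) s; rewrite subrK; have := le_trans yz zt; lra.
  rewrite -[y ^+ 2]real_normK ?num_real// -[s ^+ 2]real_normK ?num_real//.
  move: (normr_ge0 y) (normr_ge0 s); set Y := `|y|; set S := `|s| => Y0 S0 YS.
  have := ler_pM Y0 Y0 YS YS; have := sqr_ge0 (S - 1 / 2); rewrite !expr2; lra.
have : 0 <= (atan z - atan s - 2 * m * (z - s)) * t.
  rewrite Ey -mulrBl -mulrA mulr_ge0// subr_ge0 /m -[2 * _]/(2 * _).
  rewrite (_ : 2 * _ = (2 * (1 + s ^+ 2))^-1); last by field; rewrite gt_eqF.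
  by rewrite lef_pV2 ?posrE ?p// mulr_gt0.
rewrite -Ez /phi [t + s]addrC => h.
have -> : t ^+ 2 / (4 * (1 + s ^+ 2)) = m * (t * t) by rewrite mulrC expr2.
move: h; rewrite (_ : s + t - s = t); last by ring.
by rewrite subrr mul0r mulr0 subr0; lra.
Qed.

(** Amplitude and phase form of [cos c + s * sin c], squared to avoid the root. *)
Lemma cos_sub_atan (c s : R) : cos (c - atan s) ^+ 2 * (1 + s ^+ 2) = (cos c + s * sin c) ^+ 2.
Proof.
have p : 0 < 1 + s ^+ 2 by rewrite ltr_wpDr ?sqr_ge0.
have e1 : cos (atan s) ^+ 2 * (1 + s ^+ 2) = 1.
  by rewrite cos_atan exprVn sqr_sqrtr ?ltW// mulVf// gt_eqF.
have e2 : sin (atan s) = s * cos (atan s).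
  rewrite -{2}[s]atanK /tan divfK// cos_atan invr_eq0 sqrtr_eq0 -ltNge//.
rewrite cosB e2; transitivity ((cos c + s * sin c) ^+ 2 * (cos (atan s) ^+ 2 * (1 + s ^+ 2))).
  by ring.
by rewrite e1 mulr1.
Qed.

Lemma nondecreasing_derive f (df : R -> R) (a c : R) : (forall x, is_derive x (1 : R) f (df x)) ->
  (forall x, 0 <= df x) -> a <= c -> f a <= f c.
Proof.
move=> D p ac; have [z [_ _ E]] := MVT_any a c D.
by rewrite -subr_ge0 E mulr_ge0// subr_ge0.
Qed.

Lemma derive_shift f (df : R -> R) (c x : R) : (forall x, is_derive x (1 : R) f (df x)) ->
  (forall x, f (x + 1) = f x + c) -> df (x + 1) = df x.
Proof.
move=> D per.
have D1 y : is_derive y (1 : R) (fun t => f (t + 1)) (df (y + 1)).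
  have h := is_deriveDf (is_derive_id y (1 : R)) (is_derive_cst (1 : R) y (1 : R)).
  by apply: is_derive_eq (@is_derive_compf f (fun t => t + 1) _ _ _ (D (y + 1)) h) _; rewrite addr0 mulr1.
have D2 y : is_derive y (1 : R) (fun t => f (t + 1)) (df y).
  rewrite (_ : (fun t => _) = (fun t => f t + c)); last by apply/funext.
  by apply: is_derive_eq (is_deriveDf (D y) (is_derive_cst c y (1 : R))) _; rewrite addr0.
by have := derive1_eq D1; rewrite (derive1_eq D2) => /(congr1 (@^~ x)).
Qed.

Lemma is_derive_sumf (n : nat) (F dF : nat -> R -> R) x :
  (forall k, is_derive x (1 : R) (F k) (dF k x)) ->
  is_derive x (1 : R) (fun t => \sum_(0 <= k < n) F k t) (\sum_(0 <= k < n) dF k x).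
Proof.
move=> D; elim: n => [|n IH].
  rewrite big_geq// (_ : (fun _ => _) = cst 0); first exact: is_derive_cst.
  by apply/funext => t; rewrite big_geq.
rewrite big_nat_recr//= (_ : (fun _ => _) = (fun t => \sum_(0 <= k < n) F k t + F n t)).
  exact: is_deriveDf.
by apply/funext => t; rewrite big_nat_recr.
Qed.

End Calculus.

(** * Weak derivatives in the plane *)

Section PlaneMeasure.
Variable R : realType.
Local Notation leb2 := (@leb2 R).

(** The sigma-algebra in play is generated by rectangles, so [U] is exhausted by countably many
    squares with rational centres and radii [1 / (n + 1)]. *)
Lemma open_measurable_prod (U : set (R * R)) : open U -> measurable U.
Proof.
move=> oU.
pose F (p q : rat) (n : nat) : set (R * R) :=
  if `[< ball (ratr p : R) n.+1%:R^-1 `*` ball (ratr q : R) n.+1%:R^-1 `<=` U >]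
  then ball (ratr p : R) n.+1%:R^-1 `*` ball (ratr q : R) n.+1%:R^-1 else set0.
have -> : U = \bigcup_p \bigcup_q \bigcup_n F p q n.
  apply/seteqP; split => [[x y] Uxy|[x y] [p _ [q _ [n _]]]]; last first.
    by rewrite /F; case: asboolP => // + h; exact.
  have /nbhs_ballP[e /= e0 eU] := open_nbhs_nbhs (conj oU Uxy).
  have [n ne] : exists n : nat, n.+1%:R^-1 < e / 2 :> R.
    have [n _ hn] := near_infty_natSinv_lt (PosNum (divr_gt0 e0 (ltr0n R 2))).
    by exists n; exact: (hn n (leqnn n)).
  have n0 : 0 < n.+1%:R^-1 :> R by rewrite invr_gt0.
  have rat_near (t : R) : exists q : rat, ratr q \in `]t - n.+1%:R^-1, t + n.+1%:R^-1[.
    by apply: rat_in_itvoo; rewrite ltrBlDr -addrA ltrDl addr_gt0.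
  have [p hp] := rat_near x; have [q hq] := rat_near y.
  set r := (n.+1%:R^-1 : R) in n0 ne hp hq *.
  move: hp hq; rewrite !in_itv/= => /andP[p1 p2] /andP[q1 q2].
  exists p => //; exists q => //; exists n => //; rewrite /F.
  case: asboolP => [_|].
    by split => /=; rewrite /ball/= ltr_norml -/r; lra.
  case => -[x' y'] [/=]; rewrite /ball/= -/r => /ltr_normlP[hx1 hx2] /ltr_normlP[hy1 hy2].
  by apply: eU; split => /=; rewrite /ball/= ltr_norml; lra.
apply: bigcupT_measurable_rat => p; apply: bigcupT_measurable_rat => q.
apply: bigcupT_measurable => n; rewrite /F; case: ifPn => // _.
by apply: measurableX; apply: open_measurable; exact: ball_open.
Qed.

Lemma compact_measurable_prod (K : set (R * R)) : compact K -> measurable K.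
Proof.
move=> /(compact_closed (@norm_hausdorff _ _))/closed_openC.
by move/open_measurable_prod/measurableC; rewrite setCK.
Qed.

Lemma continuous_measurable_prod (f : R * R -> R) :
  continuous f -> measurable_fun setT f.
Proof.
move=> /continuousP cf; apply: (measurability _ (measurable_realfun.RGenOpens.measurableE R)).
move=> _ [_ [a [b ->] <-]]; rewrite setTI; apply: open_measurable_prod.
exact/cf/interval_open.
Qed.

Definition box (M : R) : set (R * R) := `[- M, M] `*` `[- M, M].

Lemma boxE M z : box M z <-> (`|z.1| <= M /\ `|z.2| <= M).
Proof. by case: z => x y; rewrite /box/= !in_itv/= !ler_norml. Qed.

Lemma measurable_box M : measurable (box M).
Proof. by apply: measurableX; exact: measurable_itv. Qed.

Lemma leb2_box M : (leb2 (box M) < +oo)%E.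
Proof.
rewrite /leb2 /box product_measure1E//=; try exact: measurable_itv.
rewrite lebesgue_measure_itv/=; case: ifPn => _; last by rewrite mul0e ltry.
by rewrite -EFinB -EFinM ltry.
Qed.

Lemma compact_sub_box (K : set (R * R)) : compact K -> exists2 M, 0 < M & K `<=` box M.
Proof.
move=> /compact_bounded [M [Mr h]]; exists (`|M| + 1); first by rewrite ltr_wpDl.
move=> z Kz; have /= := h (`|M| + 1) _ _ Kz.
rewrite (le_lt_trans (ler_norm M)) ?ltrDl// => /(_ isT) hz.
by apply/boxE; split; apply: le_trans hz; rewrite prod_normE le_max lexx ?orbT.
Qed.

Lemma integrable_bounded_box (f : R * R -> R) (M C : R) :
  measurable_fun setT f -> (forall z, `|f z| <= C) -> (forall z, ~ box M z -> f z = 0) ->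
  leb2.-integrable setT (EFin \o f).
Proof.
move=> mf fC f0.
apply: (@le_integrable _ _ _ leb2 setT measurableT _ (fun z => (C * \1_(box M) z)%:E)).
- exact/measurable_EFinP.
- move=> z _ /=; rewrite lee_fin indicE; have C0 := le_trans (normr_ge0 _) (fC z).
  have [bz|bz] := pselect (box M z); last by rewrite f0 ?normr0.
  by rewrite mem_set// mulr1 (le_trans (fC z))// ler_norm.
- apply/integrableP; split.
    apply/measurable_EFinP; apply: measurable_funM => //.
    by apply: measurable_indic; exact: measurable_box.
  have C0 : 0 <= C by exact: le_trans (normr_ge0 _) (fC 0).
  under eq_integral => z _ do rewrite gee0_abs ?lee_fin ?mulr_ge0 ?indicE//= EFinM.
  rewrite ge0_integralZl//=; last first.
  + by apply/measurable_EFinP; apply: measurable_indic; exact: measurable_box.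
  under eq_integral => z _ do rewrite -/((\1_(box M) : R * R -> R) z).
  rewrite integral_indic//; last exact: measurable_box.
  rewrite setIT lte_mul_pinfty ?lee_fin//; exact: leb2_box.
Qed.

Lemma continuous_box_bounded (f : R * R -> R) M : continuous f ->
  exists C, forall z, box M z -> `|f z| <= C.
Proof.
move=> cf.
have cb : compact (box M).
  by apply: compact_setX; exact: segment_compact.
have := continuous_compact (continuous_subspaceT cf) cb.
move=> /compact_bounded[C [_ h]]; exists (`|C| + 1) => z bz.
apply: (h (`|C| + 1)); last by exists z.
by rewrite (le_lt_trans (ler_norm C)) ?ltrDl.
Qed.

Lemma integrable_continuous_box (f : R * R -> R) M :
  continuous f -> (forall z, ~ box M z -> f z = 0) ->
  leb2.-integrable setT (EFin \o f).
Proof.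
move=> cf f0; have [C hC] := continuous_box_bounded M cf.
apply: (@integrable_bounded_box _ M `|C|) => //; first exact: continuous_measurable_prod.
move=> z; have [bz|bz] := pselect (box M z); last by rewrite f0 ?normr0.
by rewrite (le_trans (hC _ bz)) ?ler_norm.
Qed.

Lemma test_fun_box (phi : R * R -> R) : test_fun phi ->
  exists2 M, 0 < M & forall z, ~ box M z -> phi z = 0 /\ forall e, 'D_e phi z = 0.
Proof.
move=> [_ [K [cK K0]]]; have [M M0 KM] := compact_sub_box cK.
exists M => // z bz; have Kz : ~ K z by move/KM.
split=> [|e]; first exact: K0.
have oK : open (~` K).
  by apply: closed_openC; apply: compact_closed cK; exact: norm_hausdorff.
have : \forall w \near z, phi w = cst 0 w.
  by apply: filterS (open_nbhs_nbhs (conj oK Kz)) => w; exact: K0.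
by move=> /near_eq_derive ->; rewrite derive_cst.
Qed.

Lemma test_fun_continuous (phi : R * R -> R) : test_fun phi -> continuous phi.
Proof. by move=> [/(_ [::]) h _] z; apply: differentiable_continuous; exact: h. Qed.

Lemma test_fun_derivative_continuous (phi : R * R -> R) e : test_fun phi -> continuous ('D_e phi).
Proof. by move=> [/(_ [:: e]) h _] z; apply: differentiable_continuous; exact: h. Qed.

Lemma test_fun_partial1 (phi : R * R -> R) (x y : R) : test_fun phi ->
  is_derive x 1 (fun t => phi (t, y)) ('D_(ex R) phi (x, y)).
Proof.
move=> [/(_ [::] (x, y))/= /(@diff_derivable _ _ _ _ _ (ex R)) h _].
have E (k : R) : k *: ex R + (x, y) = (k *: 1 + x, y).
  by apply: injective_projections => //=; rewrite /GRing.scale/= mulr0 add0r.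
have D : (fun k : R => k^-1 *: (phi (k *: ex R + (x, y)) - phi (x, y))) =
         (fun k : R => k^-1 *: (phi (k *: 1 + x, y) - phi (x, y))).
  by apply/funext => k; rewrite E.
by apply: DeriveDef; rewrite /derivable /derive -D.
Qed.

Lemma test_fun_partial2 (phi : R * R -> R) (x y : R) : test_fun phi ->
  is_derive y 1 (fun t => phi (x, t)) ('D_(ey R) phi (x, y)).
Proof.
move=> [/(_ [::] (x, y))/= /(@diff_derivable _ _ _ _ _ (ey R)) h _].
have E (k : R) : k *: ey R + (x, y) = (x, k *: 1 + y).
  by apply: injective_projections => //=; rewrite /GRing.scale/= mulr0 add0r.
have D : (fun k : R => k^-1 *: (phi (k *: ey R + (x, y)) - phi (x, y))) =
         (fun k : R => k^-1 *: (phi (x, k *: 1 + y) - phi (x, y))).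
  by apply/funext => k; rewrite E.
by apply: DeriveDef; rewrite /derivable /derive -D.
Qed.

Lemma continuous_line1 (f : R * R -> R) y : continuous f -> continuous (fun t => f (t, y)).
Proof.
move=> cf t; apply: (@continuous_comp _ _ _ (fun t => (t, y)) f); last exact: cf.
exact: (cvg_pair cvg_id (cvg_cst y)).
Qed.

Lemma continuous_line2 (f : R * R -> R) x : continuous f -> continuous (fun t => f (x, t)).
Proof.
move=> cf t; apply: (@continuous_comp _ _ _ (fun t => (x, t)) f); last exact: cf.
exact: (cvg_pair (cvg_cst x) cvg_id).
Qed.

Lemma integral_derivative_eq0 (F f : R -> R) (M : R) : 0 < M -> continuous f ->
  (forall x : R, is_derive x (1 : R) F (f x)) ->
  (forall x, M < `|x| -> f x = 0) -> F M = 0 -> F (- M) = 0 ->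
  (\int[lebesgue_measure]_x (f x)%:E = 0)%E.
Proof.
move=> M0 cf dF f0 F1 F2.
have -> : (fun x => (f x)%:E) = (EFin \o f) \_ `[- M, M].
  apply/funext => x; rewrite patchE; case: ifPn => //.
  rewrite notin_setE/= in_itv/= -ler_norml => /negP; rewrite -ltNge => /f0 -> //.
rewrite -integral_mkcond (@continuous_FTC2 _ f F)//.
- by rewrite F1 F2 subee.
- by rewrite gtrN.
- exact: continuous_subspaceT.
- split.
  + by move=> x _; have [] := dF x.
  + by apply: cvg_at_right_filter; apply: differentiable_continuous; apply/derivable1_diffP; have [] := dF (- M).
  + by apply: cvg_at_left_filter; apply: differentiable_continuous; apply/derivable1_diffP; have [] := dF M.
- by move=> x _; rewrite derive1E; have [] := dF x.
Qed.

(** When [g] is the derivative of [u] along [e], the integrand is that of [u * phi], and integration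
    by parts becomes one vanishing integral. Integrability of the two halves allows the splitting,
    that of their sum allows Fubini. *)
Lemma weak_deriv_split (e : R * R) (u g : R * R -> R) (phi : R * R -> R) M :
  (forall z, ~ box M z -> phi z = 0 /\ forall e, 'D_e phi z = 0) ->
  test_fun phi -> continuous u -> continuous g ->
  (leb2.-integrable setT (fun z => (u z * 'D_e phi z + g z * phi z)%:E) /\
  (\int[leb2]_z (u z * 'D_e phi z + g z * phi z)%:E = 0 ->
  \int[leb2]_z (u z * 'D_e phi z)%:E = - \int[leb2]_z (g z * phi z)%:E))%E.
Proof.
move=> hM tphi cu cg.
have i1 : leb2.-integrable setT (EFin \o (fun z => u z * 'D_e phi z)).
  apply: (@integrable_continuous_box _ M) => [z|z /hM[_ ->]]; last by rewrite mulr0.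
  by apply: cvgM; [exact: cu|exact: test_fun_derivative_continuous].
have i2 : leb2.-integrable setT (EFin \o (fun z => g z * phi z)).
  apply: (@integrable_continuous_box _ M) => [z|z /hM[-> _]]; last by rewrite mulr0.
  by apply: cvgM; [exact: cg|exact: test_fun_continuous].
split.
  have -> : (fun z => (u z * 'D_e phi z + g z * phi z)%:E) =
    ((EFin \o (fun z => u z * 'D_e phi z)%R) \+ (EFin \o (fun z => g z * phi z)%R))%E.
    by apply/funext => z /=; rewrite EFinD.
  exact: integrableD.
under eq_integral do rewrite EFinD.
have f1 := integrable_fin_num measurableT i1; have f2 := integrable_fin_num measurableT i2.
rewrite integralD//; move: f1 f2 => /=.
case: (\int[_]_x _)%E => // a _; case: (\int[_]_x _)%E => // c _.
by rewrite -EFinD => -[/eqP]; rewrite addr_eq0 => /eqP ->.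
Qed.

Lemma weak_deriv_ex_C1 (u g : R * R -> R) : continuous u -> continuous g ->
  (forall x y : R, is_derive x (1 : R) (fun t => u (t, y)) (g (x, y))) ->
  weak_deriv (ex R) u g.
Proof.
move=> cu cg dug phi tphi; have [M M0 hM] := test_fun_box tphi.
have [hi] := weak_deriv_split (ex R) hM tphi cu cg; apply.
rewrite -(integral21_prod_meas1 hi); apply: integral0_eq => y _.
rewrite /fubini_G.
have hx x : M < `|x| -> phi (x, y) = 0 /\ 'D_(ex R) phi (x, y) = 0.
  move=> Mx; have [|-> ->] := hM (x, y) => //.
  by rewrite boxE/= => -[]; rewrite leNgt Mx.
(* The box is closed, so [phi] is known to vanish only strictly beyond [M]; the endpoints [M + 1]
   and [- (M + 1)] make the boundary terms zero. *)
have M1 : M < `|M + 1| by rewrite ger0_norm ?ltrDl// addr_ge0 ?ltW.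
apply: (@integral_derivative_eq0 (fun t => u (t, y) * phi (t, y)) _ (M + 1)).
- by rewrite addr_gt0.
- apply: (@continuous_line1 (fun z => u z * 'D_(ex R) phi z + g z * phi z)) => z.
  apply: cvgD; apply: cvgM; first [exact: cu|exact: cg|exact: test_fun_continuous|exact: test_fun_derivative_continuous].
- by move=> x; exact: (is_deriveMf (dug x y) (test_fun_partial1 x y tphi)).
- move=> x Mx; have [|-> ->] := hx x; last by rewrite !mulr0 addr0.
  by rewrite (lt_trans _ Mx)// ltrDl.
- by have [-> _] := hx _ M1; rewrite mulr0.
- by have [|-> _] := hx (- (M + 1)); rewrite ?normrN// mulr0.
Qed.

Lemma weak_deriv_ey_C1 (u g : R * R -> R) : continuous u -> continuous g ->
  (forall x y : R, is_derive y (1 : R) (fun t => u (x, t)) (g (x, y))) ->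
  weak_deriv (ey R) u g.
Proof.
move=> cu cg dug phi tphi; have [M M0 hM] := test_fun_box tphi.
have [hi] := weak_deriv_split (ey R) hM tphi cu cg; apply.
rewrite -(integral12_prod_meas1 hi); apply: integral0_eq => x _.
rewrite /fubini_F.
have hy y : M < `|y| -> phi (x, y) = 0 /\ 'D_(ey R) phi (x, y) = 0.
  move=> My; have [|-> ->] := hM (x, y) => //.
  by rewrite boxE/= => -[_]; rewrite leNgt My.
have M1 : M < `|M + 1| by rewrite ger0_norm ?ltrDl// addr_ge0 ?ltW.
apply: (@integral_derivative_eq0 (fun t => u (x, t) * phi (x, t)) _ (M + 1)).
- by rewrite addr_gt0.
- apply: (@continuous_line2 (fun z => u z * 'D_(ey R) phi z + g z * phi z)) => z.
  apply: cvgD; apply: cvgM; first [exact: cu|exact: cg|exact: test_fun_continuous|exact: test_fun_derivative_continuous].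
- by move=> y; exact: (is_deriveMf (dug x y) (test_fun_partial2 x y tphi)).
- move=> y My; have [|-> ->] := hy y; last by rewrite !mulr0 addr0.
  by rewrite (lt_trans _ My)// ltrDl.
- by have [-> _] := hy _ M1; rewrite mulr0.
- by have [|-> _] := hy (- (M + 1)); rewrite ?normrN// mulr0.
Qed.

Lemma axis_negligible : leb2.-negligible [set z : R * R | z.2 = 0].
Proof.
exists (setT `*` [set 0]); split.
- by apply: measurableX => //; exact: measurable_set1.
- by rewrite /leb2 product_measure1E//= ?lebesgue_measure_set1 ?mule0//; exact: measurable_set1.
- by move=> [x y] /= ->.
Qed.

Lemma integrable_cst_box (M C : R) : leb2.-integrable (box M) (EFin \o cst C).
Proof.
apply/integrableP; split; first exact/measurable_EFinP.
rewrite (eq_integral (cst `|C|%:E)) => [|//].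
rewrite integral_cst//; last exact: measurable_box.
by rewrite lte_mul_pinfty ?lee_fin//; exact: leb2_box.
Qed.

(** Meant for derivatives that may diverge on the axis: it is a null set, so convergence and
    domination are asked for off it. A test function lives in one box, where dominated convergence
    passes both sides of the identity to the limit. *)
Lemma weak_deriv_lim (e : R * R) (u g : nat -> R * R -> R) (u' g' : R * R -> R) :
  (forall n, weak_deriv e (u n) (g n)) ->
  (forall n, continuous (u n)) -> (forall n, continuous (g n)) ->
  measurable_fun setT u' -> measurable_fun setT g' ->
  (forall z, z.2 != 0 -> u n z @[n --> \oo] --> u' z) ->
  (forall z, z.2 != 0 -> g n z @[n --> \oo] --> g' z) ->
  (forall M, exists2 h : R * R -> R, leb2.-integrable (box M) (EFin \o h) &
    forall n z, box M z -> z.2 != 0 -> `|u n z| <= h z /\ `|g n z| <= h z) ->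
  weak_deriv e u' g'.
Proof.
move=> wug cu cg mu' mg' uu' gg' hdom phi tphi.
have [M M0 hM] := test_fun_box tphi; have [h ih hh] := hdom M.
have dom (v : nat -> R * R -> R) (v' psi : R * R -> R) :
    continuous psi -> (forall z, ~ box M z -> psi z = 0) ->
    (forall n, continuous (v n)) -> measurable_fun setT v' ->
    (forall z, z.2 != 0 -> v n z @[n --> \oo] --> v' z) ->
    (forall n z, box M z -> z.2 != 0 -> `|v n z| <= h z) ->
    ((\int[leb2]_z (v n z * psi z)%:E)%E @[n --> \oo] --> (\int[leb2]_z (v' z * psi z)%:E)%E).
  move=> cpsi psi0 cv mv' vv' vh.
  have [C hC] := continuous_box_bounded M cpsi.
  have mpsi := continuous_measurable_prod cpsi.
  have restr (w : R * R -> R) : (\int[leb2]_z (w z * psi z)%:E = \int[leb2]_(z in box M) (w z * psi z)%:E)%E.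
    rewrite [RHS]integral_mkcond; apply: eq_integral => z _; rewrite patchE.
    by case: ifPn => //; rewrite notin_setE => /psi0 ->; rewrite mulr0.
  rewrite restr; under eq_fun do rewrite restr.
  have mb := @measurable_box M.
  have [] := @dominated_convergence _ _ _ leb2 (box M) mb
     (fun n z => (v n z * psi z)%:E) (fun z => (v' z * psi z)%:E) (fun z => `|C|%:E * (h z)%:E)%E.
  - move=> n; apply/measurable_EFinP; apply: measurable_funTS.
    by apply: measurable_funM => //; exact: continuous_measurable_prod.
  - by apply/measurable_EFinP; apply: measurable_funTS; apply: measurable_funM.
  - apply: negligibleS axis_negligible => z /= hz; apply: contrapT => /eqP z0.
    apply: hz => _; apply/cvg_EFin; first by apply: nearW.
    by apply: cvgM; [exact: vv'|exact: cvg_cst].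
  - exact: integrableZl.
  - apply: negligibleS axis_negligible => z /= hz; apply: contrapT => /eqP z0.
    apply: hz => n bz; rewrite -EFinM lee_fin normrM mulrC ler_pM//; last exact: vh.
    by rewrite (le_trans (hC _ bz))// ler_norm.
  by [].
have l1 := dom u u' ('D_e phi) (test_fun_derivative_continuous tphi) (fun z bz => (hM z bz).2 e)
  cu mu' uu' (fun n z b z0 => (hh n z b z0).1).
have l2 := dom g g' phi (test_fun_continuous tphi) (fun z bz => (hM z bz).1)
  cg mg' gg' (fun n z b z0 => (hh n z b z0).2).
move: l1; rewrite (_ : (fun n => _) = (fun n => - \int[leb2]_z (g n z * phi z)%:E)%E); last first.
  by apply/funext => n; exact: wug.
by move=> /cvg_unique; apply => //; exact: cvgeN.
Qed.

Lemma L2loc_dominated (g : R * R -> R) : measurable_fun setT g ->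
  (forall M, exists2 h : R * R -> R, leb2.-integrable (box M) (EFin \o h) &
    forall z, box M z -> z.2 != 0 -> g z ^+ 2 <= h z) ->
  L2loc g.
Proof.
move=> mg hdom K cK; have mK := compact_measurable_prod cK.
have mg2 D : measurable_fun D (fun z => (g z ^+ 2)%:E).
  by apply/measurable_EFinP/measurable_funX/measurable_funTS.
split; first exact: measurable_funTS.
have [M _ KM] := compact_sub_box cK; have [h ih hh] := hdom M.
apply: (@integrableS _ _ _ leb2 _ _ _ (measurable_box M) mK KM).
apply/integrableP; split; first exact: mg2.
have mabs : measurable_fun (box M) (abse \o (EFin \o h)).
  by apply: measurableT_comp => //; case/integrableP: ih.
case/integrableP: (ih) => mh; apply: le_lt_trans.
apply: ae_ge0_le_integral => //; first exact: measurable_box.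
  rewrite (_ : (fun _ => _) = (fun z => (g z ^+ 2)%:E)); first exact: mg2.
  by apply/funext => z; rewrite gee0_abs// lee_fin sqr_ge0.
apply: negligibleS axis_negligible => z /= hz; apply: contrapT => /eqP z0.
apply: hz => bz; rewrite lee_fin ger0_norm ?sqr_ge0//.
by rewrite (le_trans (hh _ bz z0)) ?ler_norm.
Qed.

Lemma L2loc_continuous (g : R * R -> R) : continuous g -> L2loc g.
Proof.
move=> cg; apply: L2loc_dominated => [|M]; first exact: continuous_measurable_prod.
have [C hC] := continuous_box_bounded M cg.
exists (cst (`|C| ^+ 2)); first exact: integrable_cst_box.
move=> z bz _; rewrite -real_normK ?num_real//= lerXn2r ?nnegrE//.
by rewrite (le_trans (hC _ bz)) ?ler_norm.
Qed.

(** * Sums of weights over strips around the real axis *)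

Section StripSeries.
Variables (a r : nat -> R).
Hypotheses (a0 : forall n, 0 <= a n) (r0 : forall n, 0 <= r n).

Definition strip_term (n : nat) (z : R * R) : R := a n * (`|z.2| <= r n)%R%:R.

Definition strip_sum (z : R * R) : \bar R := (\sum_(0 <= n <oo) (strip_term n z)%:E)%E.

Lemma strip_term_ge0 n z : 0 <= strip_term n z.
Proof. by rewrite mulr_ge0. Qed.

Lemma strip_sum_ge0 z : (0 <= strip_sum z)%E.
Proof. by apply: nneseries_ge0 => k _ _; rewrite lee_fin strip_term_ge0. Qed.

(** Only finitely many strips contain [z], so the extended sum is a finite one and [fine] loses
    nothing. *)
Lemma strip_sum_ge z N m : (forall n, (m <= n)%N -> r n < `|z.2|) ->
  \sum_(0 <= n < N) strip_term n z <= fine (strip_sum z).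
Proof.
move=> hm.
have E : strip_sum z = (\sum_(0 <= n < m) (strip_term n z)%:E)%E.
  rewrite /strip_sum (@nneseries_split _ _ 0%N m)// ?add0n; last first.
    by move=> k _; rewrite lee_fin strip_term_ge0.
  rewrite [X in (_ + X)%E]eseries0 ?adde0// => k mk _.
  by rewrite /strip_term leNgt hm// mulr0.
have : (\sum_(0 <= n < N) (strip_term n z)%:E <= strip_sum z)%E.
  by apply: nneseries_lim_ge => k _ _; rewrite lee_fin strip_term_ge0.
by rewrite E !sumEFin lee_fin.
Qed.

Lemma measurable_strip (t : R) : measurable (setT `*` `[- t, t] : set (R * R)).
Proof. by apply: measurableX => //; exact: measurable_itv. Qed.

Lemma strip_termE n : strip_term n = (fun z => a n * \1_(setT `*` `[- r n, r n]) z).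
Proof.
apply/funext => -[x y]; rewrite indicE/=; congr (_ * (_%:R)); congr nat_of_bool.
rewrite /= ler_norml; apply/idP/idP; first by rewrite inE/= in_itv.
by rewrite inE/= => -[_]/=; rewrite in_itv.
Qed.

Lemma measurable_strip_term n : measurable_fun setT (fun z => (strip_term n z)%:E).
Proof.
apply/measurable_EFinP; rewrite strip_termE; apply: measurable_funM => //.
by apply: measurable_indic; exact: measurable_strip.
Qed.

(** Within the box the strip lies in a rectangle of sides [2 * |M|] and [2 * r n]; the absolute
    value covers negative [M]. *)
Lemma integral_strip_term (M : R) n :
  (\int[leb2]_(z in box M) (strip_term n z)%:E <= (4 * `|M|)%:E * (a n * r n)%:E)%E.
Proof.
rewrite strip_termE; under eq_integral do rewrite EFinM.
have mS := measurable_strip (r n); have mB := measurable_box M.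
rewrite ge0_integralZl//=; last 2 first.
- by apply/measurable_EFinP; apply: measurable_indic.
- by rewrite lee_fin.
rewrite integral_indic//.
pose S : set (R * R) := `[- `|M|, `|M|] `*` `[- r n, r n].
apply: (@le_trans _ _ ((a n)%:E * leb2 S)%E).
  apply: lee_wpmul2l; first by rewrite lee_fin.
  apply: le_measure; rewrite ?inE; [exact: measurableI| |].
    by apply: measurableX; exact: measurable_itv.
  move=> [x y] [[_ hy]] /boxE[hx _]; split => //=.
  by rewrite in_itv/= -ler_norml (le_trans hx)// ler_norm.
rewrite /leb2 /S product_measure1E//=; [|exact: measurable_itv..].
have len (t : R) : 0 <= t -> lebesgue_measure (`[- t, t] : set R) = (2 * t)%:E.
  move=> t0; rewrite lebesgue_measure_itv/= lte_fin; case: ltP => h.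
    by rewrite -EFinB opprK; congr _%:E; rewrite mulr2n mulrDl mul1r.
  have -> : t = 0 by apply/eqP; rewrite eq_le t0 andbT; lra.
  by rewrite mulr0.
by rewrite !len// -!EFinM lee_fin; lra.
Qed.

Lemma integrable_strip_sum (M : R) : (\sum_(0 <= n <oo) (a n * r n)%:E < +oo)%E ->
  leb2.-integrable (box M) (EFin \o (fine \o strip_sum)).
Proof.
move=> ar; have mB := measurable_box M.
have mS : measurable_fun (box M) strip_sum.
  apply: ge0_emeasurable_sum => [k z _ _|k _]; first by rewrite lee_fin strip_term_ge0.
  by apply: measurable_funTS; exact: measurable_strip_term.
have mF : measurable_fun (box M) (EFin \o (fine \o strip_sum)).
  by apply/measurable_EFinP; apply: (measurableT_comp (fine_measurable _)) => //.
apply/integrableP; split => //.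
(* Where [strip_sum] is [+oo], [fine] returns 0, so the extended sum is a bound everywhere; it can
   be integrated termwise. *)
apply: (@le_lt_trans _ _ (\int[leb2]_(z in box M) strip_sum z)%E).
  apply: ge0_le_integral => //; first exact: measurableT_comp.
  move=> z _ /=; rewrite ger0_norm ?fine_ge0 ?strip_sum_ge0//.
  by case: (strip_sum z) (strip_sum_ge0 z) => //= _; rewrite leey.
rewrite integral_nneseries//; last 2 first.
- by move=> n; by apply: measurable_funTS; exact: measurable_strip_term.
- by move=> n z _; rewrite lee_fin strip_term_ge0.
apply: (@le_lt_trans _ _ (\sum_(0 <= n <oo) ((4 * `|M|)%:E * (a n * r n)%:E))%E).
  apply: lee_nneseries => n _; last exact: integral_strip_term.
  by move=> _; apply: integral_ge0 => z _; rewrite lee_fin strip_term_ge0.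
rewrite nneseriesZl; last by move=> n _; rewrite lee_fin mulr_ge0.
by rewrite lte_mul_pinfty// lee_fin mulr_ge0.
Qed.

End StripSeries.

End PlaneMeasure.

(** * Series whose derivatives live in shrinking strips *)

Section PlaneSeries.
Variable R : realType.
Variables (e : R * R) (u0 g0 : R * R -> R) (G G' : nat -> R * R -> R) (r : nat -> R).
Hypothesis cu0 : continuous u0.
Hypothesis cg0 : continuous g0.
Hypothesis cG : forall n, continuous (G n).
Hypothesis cG' : forall n, continuous (G' n).
Hypothesis u0_bound : forall z, `|u0 z| <= `|z.1| + `|z.2|.
Hypothesis g0_bound : forall z, `|g0 z| <= 1.
Hypothesis r_ge0 : forall n, 0 <= r n.
Hypothesis r_small : forall n, r n <= 8^-1 ^+ n.
Hypothesis G_bound : forall n z, `|G n z| <= 2^-1 ^+ n.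
Hypothesis G'_bound : forall n z, `|G' n z| <= 2 ^+ n * (`|z.2| <= r n)%R%:R.

Definition psum (f : R * R -> R) (F : nat -> R * R -> R) (N : nat) (z : R * R) : R :=
  f z + \sum_(0 <= n < N) F n z.

Lemma psumS (f : R * R -> R) (F : nat -> R * R -> R) N z : psum f F N.+1 z = psum f F N z + F N z.
Proof. by rewrite /psum big_nat_recr//= addrA. Qed.

Lemma psum0 (f : R * R -> R) (F : nat -> R * R -> R) z : psum f F 0 z = f z.
Proof. by rewrite /psum big_geq// addr0. Qed.

Hypothesis psum_weak : forall N, weak_deriv e (psum u0 G N) (psum g0 G' N).

Definition series_fun (z : R * R) : R := limn (psum u0 G ^~ z).
(** Every strip contains the axis, where the series may diverge. The value 0 on this null set makes
    the function an everywhere pointwise limit of measurable ones. *)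
Definition series_deriv (z : R * R) : R :=
  if z.2 == 0 then 0 else limn (psum g0 G' ^~ z).

Lemma continuous_psum f F N : continuous f -> (forall n, continuous (F n)) ->
  continuous (psum f F N).
Proof.
move=> cf cF z; rewrite /psum; apply: cvgD; first exact: cf.
elim: N => [|N IH].
  rewrite (_ : (fun _ => _) = cst 0); last by apply/funext => w; rewrite big_geq.
  by rewrite big_geq//; exact: cvg_cst.
rewrite big_nat_recr//= (_ : (fun _ => _) = (fun w => \sum_(0 <= n < N) F n w + F N w)).
  by apply: cvgD => //; exact: cF.
by apply/funext => w; rewrite big_nat_recr.
Qed.

Lemma geometric_half_tail N M : (N <= M)%N -> \sum_(N <= n < M) 2^-1 ^+ n <= 2 * 2^-1 ^+ N :> R.
Proof.
move=> NM; suff : \sum_(N <= n < M) 2^-1 ^+ n <= 2 * 2^-1 ^+ N - 2 * 2^-1 ^+ M :> R.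
  by have : 0 <= 2^-1 ^+ M :> R by []; lra.
rewrite -(subnK NM); elim: (M - N)%N => [|k IH]; first by rewrite add0n big_geq// subrr.
by rewrite addSn big_nat_recr ?leq_addl//= exprS; lra.
Qed.

Lemma psum_cauchy N M z : (N <= M)%N -> `|psum u0 G M z - psum u0 G N z| <= 2 * 2^-1 ^+ N.
Proof.
move=> NM; rewrite /psum (big_cat_nat (leq0n N) NM)//= opprD addrACA subrr add0r addrAC subrr add0r.
apply: le_trans (ler_norm_sum _ _ _) _; apply: le_trans (geometric_half_tail NM).
by apply: ler_sum => n _; exact: G_bound.
Qed.

Lemma half_small (y : R) : 0 < y -> exists N, 2 * 2^-1 ^+ N < y.
Proof.
move=> y0; have [N _ hN] := near_infty_natSinv_lt (PosNum (divr_gt0 y0 (ltr0n R 2))).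
have gen (s t : R) : t <= s -> s < y / 2 -> 2 * t < y by lra.
exists N; apply: gen (hN N (leqnn N)).
suff : 2^-1 ^+ N <= N.+1%:R^-1 :> R.
  by [].
by rewrite exprVn lef_pV2 ?posrE ?exprn_gt0// -natrX ler_nat ltn_expl.
Qed.

Lemma psum_cvg z : psum u0 G N z @[N --> \oo] --> series_fun z.
Proof.
suff : cvgn (psum u0 G ^~ z) by [].
apply: is_cvgD; first exact: is_cvg_cst.
apply: normed_cvg; apply: (@series_le_cvg _ _ (geometric 1 2^-1)) => //.
- by move=> n /=.
- by move=> n; apply: geometric_ge0.
- by move=> n; rewrite /geometric/= mul1r; exact: G_bound.
- by apply: is_cvg_geometric_series; rewrite ger0_norm//; lra.
Qed.

Lemma psum_dist N z : `|series_fun z - psum u0 G N z| <= 2 * 2^-1 ^+ N.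
Proof.
have h : `|psum u0 G M z - psum u0 G N z| @[M --> \oo] --> `|series_fun z - psum u0 G N z|.
  by apply: cvg_norm; apply: cvgB; [exact: psum_cvg|exact: cvg_cst].
rewrite -(cvg_lim _ h)//; apply: limr_le; first by apply/cvg_ex; eexists; exact: h.
by exists N => // M /= NM; exact: psum_cauchy.
Qed.

Lemma continuous_series_fun : continuous series_fun.
Proof.
move=> z; apply/cvgrPdist_lt => y y0.
have [N hN] := half_small (divr_gt0 y0 (ltr0n R 3)).
have := @continuous_psum _ _ N cu0 cG z => /cvgrPdist_lt/(_ (y / 3) (divr_gt0 y0 (ltr0n R 3))).
apply: filterS => w hw.
have h1 := psum_dist N z; have h2 := psum_dist N w.
rewrite (_ : _ - _ = (series_fun z - psum u0 G N z) + (psum u0 G N z - psum u0 G N w)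
   - (series_fun w - psum u0 G N w)); last by ring.
apply: le_lt_trans (ler_normB _ _) _.
have := ler_normD (series_fun z - psum u0 G N z) (psum u0 G N z - psum u0 G N w).
lra.
Qed.

Lemma r_lt (y : R) : 0 < y -> exists m, forall n, (m <= n)%N -> r n < y.
Proof.
move=> y0; have [m hm] := half_small y0; exists m => n mn.
apply: le_lt_trans (r_small n) _; apply: le_lt_trans hm.
apply: (@le_trans _ _ (2^-1 ^+ n)).
  by apply: lerXn2r; rewrite ?nnegrE//; lra.
apply: (@le_trans _ _ (2^-1 ^+ m)); last by have : 0 <= 2^-1 ^+ m :> R by []; lra.
by apply: ler_wiXn2l => //; lra.
Qed.

Lemma psum_deriv_stable z m N : (forall n, (m <= n)%N -> r n < `|z.2|) -> (m <= N)%N ->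
  psum g0 G' N z = psum g0 G' m z.
Proof.
move=> hm mN; rewrite /psum (big_cat_nat (leq0n m) mN)//= [X in _ + (_ + X)]big_nat_cond.
rewrite [X in _ + (_ + X)]big1 ?addr0// => n /andP[/andP[mn _] _]; apply/eqP; rewrite -normr_le0.
by apply: le_trans (G'_bound n z) _; rewrite [_ <= r n]leNgt hm// mulr0.
Qed.

Lemma series_derivE z m N : (forall n, (m <= n)%N -> r n < `|z.2|) -> (m <= N)%N ->
  psum g0 G' N z = series_deriv z.
Proof.
move=> hm mN; rewrite /series_deriv ifF.
  rewrite (psum_deriv_stable hm mN); apply/esym/lim_near_cst => //.
  by exists m => // k /= mk; exact: psum_deriv_stable.
apply/eqP => z0; have := hm m (leqnn m); rewrite z0 normr0.
by rewrite ltNge r_ge0.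
Qed.

Lemma series_deriv_eventually z : z.2 != 0 ->
  exists m, forall N, (m <= N)%N -> psum g0 G' N z = series_deriv z.
Proof.
rewrite -normr_gt0 => /r_lt[m hm]; exists m => N; exact: series_derivE.
Qed.

Lemma psum_deriv_cvg z : z.2 != 0 -> psum g0 G' N z @[N --> \oo] --> series_deriv z.
Proof.
move=> /series_deriv_eventually[m hm]; apply: cvg_near_cst.
by exists m => // N /= mN; rewrite hm.
Qed.

Lemma measurable_axis_compl : measurable [set z : R * R | z.2 != 0].
Proof.
apply: open_measurable_prod.
rewrite (_ : [set _ | _] = (fun z : R * R => z.2) @^-1` [set y | y != 0]) //.
by apply: open_comp; [move=> z _; exact: cvg_snd|exact: open_neq].
Qed.

Lemma measurable_series_deriv : measurable_fun setT series_deriv.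
Proof.
(* The indicator forces convergence on the axis as well, to the value 0 fixed in [series_deriv]. *)
apply: (@measurable_fun_cvg _ _ _ setT (fun N z => \1_[set z : R * R | z.2 != 0] z * psum g0 G' N z)).
  move=> N; apply: measurable_funM; first by apply: measurable_indic; exact: measurable_axis_compl.
  by apply: continuous_measurable_prod; exact: continuous_psum.
move=> z _; have [z0|z0] := eqVneq z.2 0.
  rewrite /series_deriv z0 eqxx (_ : (fun _ => _) = cst 0); first exact: cvg_cst.
  by apply/funext => N; rewrite indicE memNset ?mul0r//= z0 eqxx.
rewrite (_ : (fun _ => _) = psum g0 G' ^~ z); first exact: psum_deriv_cvg.
by apply/funext => N; rewrite indicE mem_set ?mul1r.
Qed.

(* [1 + sum_(n < k) 2^n <= 2^k], so squaring the partial sums of the derivative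
   costs only a constant: the square is dominated by the sum of [4^n] over the
   strips containing [z]. *)
Definition majorant (z : R * R) : R :=
  3 * (1 + fine (strip_sum (fun n => 4 ^+ n) r z)).

Lemma psum_deriv_sq z N : z.2 != 0 ->
  `|psum g0 G' N z| <= majorant z /\ psum g0 G' N z ^+ 2 <= majorant z.
Proof.
move=> z0; have [m hm] : exists m, forall n, (m <= n)%N -> r n < `|z.2|.
  by apply: r_lt; rewrite normr_gt0.
have Q := strip_sum_ge (fun n => exprn_ge0 n (ler0n R 4)) N hm.
pose S k : R := 1 + \sum_(0 <= n < k) 2 ^+ n * (`|z.2| <= r n)%R%:R.
have S1 k : 1 <= S k.
  by rewrite lerDl sumr_ge0// => n _; rewrite mulr_ge0.
have S2 k : S k <= 2 ^+ k.
  elim: k => [|k IH]; first by rewrite /S big_geq// addr0 expr0.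
  rewrite /S big_nat_recr//= addrA exprS mulr2n mulrDl !mul1r; apply: lerD => //.
  by rewrite ler_piMr// lern1 leq_b1.
have SQ k : S k ^+ 2 <= 3 * (1 + \sum_(0 <= n < k) strip_term (fun n => 4 ^+ n) r n z).
  elim: k => [|k IH]; first by rewrite /S !big_geq// !addr0 expr1n mulr1; lra.
  rewrite /S !big_nat_recr//= addrA -/(S k) /strip_term.
  case: (`|z.2| <= r k); last by rewrite !mulr0 !addr0.
  rewrite !mulr1 (_ : 4 ^+ k = 2 ^+ k * 2 ^+ k :> R); last first.
    by rewrite -exprMn; congr (_ ^+ _); lra.
  (* For [0 <= s <= t], [(s + t)^2 = s^2 + 2 s t + t^2 <= s^2 + 3 t^2]: this is the constant 3 of
     [majorant]. Here [t] is [2 ^+ k], which dominates [S k]. *)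
  have gen (s t A : R) : s ^+ 2 <= 3 * (1 + A) -> 1 <= s -> s <= t ->
      (s + t) ^+ 2 <= 3 * (1 + (A + t * t)).
    move=> h1 h2 h3; have t0 : 0 <= t by lra.
    by have := ler_wpM2r t0 h3; move: h1; rewrite !expr2; lra.
  exact: gen IH (S1 k) (S2 k).
have pS : `|psum g0 G' N z| <= S N.
  apply: le_trans (ler_normD _ _) _; apply: lerD => //.
  apply: le_trans (ler_norm_sum _ _ _) _; apply: ler_sum => n _; exact: G'_bound.
have SM : S N ^+ 2 <= majorant z.
  by apply: le_trans (SQ N) _; apply: ler_wpM2l => //; rewrite lerD2l.
split.
  apply: le_trans pS _; apply: le_trans SM.
  by rewrite expr2 ler_peMl// (le_trans _ (S1 N)).
apply: le_trans SM; rewrite -[_ ^+ 2]real_normK ?num_real//.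
by apply: lerXn2r; rewrite ?nnegrE// (le_trans _ (S1 N)).
Qed.

Lemma integrable_majorant (M : R) : (@leb2 R).-integrable (box M) (EFin \o majorant).
Proof.
rewrite (_ : EFin \o majorant =
   (fun z => 3%:E * ((EFin \o cst 1%R) z + (EFin \o (fine \o strip_sum (fun n => 4 ^+ n)%R r)) z))%E).
  apply: integrableZl; first exact: measurable_box.
  apply: integrableD; [exact: measurable_box|exact: integrable_cst_box|].
  apply: integrable_strip_sum => [n|n|]; [exact: exprn_ge0|exact: r_ge0|].
  (* The terms are at most [4^n * 8^(-n) = 2^(-n)], written as [2 / 2^(n + 1)] to match the standard
     halving series. *)
  apply: (@le_lt_trans _ _ (\sum_(0 <= n <oo) ((2 / (2 ^ (n + 1))%:R)%:E))%E).
    apply: lee_nneseries => n _; first by move=> _; rewrite lee_fin mulr_ge0// exprn_ge0.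
    rewrite lee_fin; apply: le_trans (ler_wpM2l (exprn_ge0 n (ler0n R 4)) (r_small n)) _.
    rewrite -exprMn addn1 natrX exprS invfM mulrA divff ?mul1r// -exprVn.
    by rewrite (_ : 4 / 8 = 2^-1 :> R)//; lra.
  by have /cvg_lim -> // := @cvg_geometric_eseries_half R 2 0; rewrite ltry.
by apply/funext => z.
Qed.

Lemma L2loc_series_deriv : L2loc series_deriv.
Proof.
apply: L2loc_dominated; first exact: measurable_series_deriv.
move=> M; exists majorant; first exact: integrable_majorant.
move=> z _ z0; have [m hm] := series_deriv_eventually z0.
by rewrite -(hm m (leqnn m)); case: (psum_deriv_sq m z0).
Qed.

Lemma weak_deriv_series : weak_deriv e series_fun series_deriv.
Proof.
apply: (weak_deriv_lim psum_weak).
- by move=> N; exact: continuous_psum.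
- by move=> N; exact: continuous_psum.
- by apply: continuous_measurable_prod; exact: continuous_series_fun.
- exact: measurable_series_deriv.
- by move=> z _; exact: psum_cvg.
- by move=> z; exact: psum_deriv_cvg.
(* Partial sums stay within 2 of [u0], hence below [2 * M + 2] on the box; adding [majorant] lets
   one function dominate the derivatives too. *)
move=> M; exists (fun z => (2 * M + 4) + majorant z).
  rewrite (_ : EFin \o _ = (fun z => (EFin \o cst (2 * M + 4)%R) z + (EFin \o majorant) z)%E)//.
  apply: integrableD; [exact: measurable_box|exact: integrable_cst_box|exact: integrable_majorant].
move=> N z /boxE[z1 z2] z0; have [h _] := psum_deriv_sq N z0.
have m0 : 0 <= majorant z by exact: le_trans (normr_ge0 _) h.
have M0 : 0 <= M by exact: le_trans (normr_ge0 _) z1.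
split; last by lra.
have := psum_cauchy z (leq0n N); rewrite expr0.
have -> : psum u0 G 0 z = u0 z by rewrite /psum big_geq// addr0.
have := u0_bound z; have := ler_normD (psum u0 G N z - u0 z) (u0 z); rewrite subrK.
lra.
Qed.

End PlaneSeries.

(** * A cut-off function *)

Section Cutoff.
Variable R : realType.

(** A quadratic remainder can be checked by cases of sign, which suits the squared positive part at
    its kink. *)
Lemma is_derive_quadratic (f : R -> R) (x l C : R) :
  (forall h, `|f (x + h) - f x - h * l| <= C * h ^+ 2) -> is_derive x (1 : R) f l.
Proof.
move=> hf.
have h : h^-1 *: (f (h *: 1 + x) - f x) @[h --> 0^'] --> l.
  apply/cvgrPdist_lt => e e0; near=> h.
  have h0 : h != 0 by near: h; exact: nbhs_dnbhs_neq.
  rewrite (_ : h *: 1 + x = x + h); last by rewrite addrC /GRing.scale/= mulr1.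
  rewrite (_ : l - _ = - (h^-1 * (f (x + h) - f x - h * l))); last first.
    have E (A : R) : h^-1 * (A - h * l) = h^-1 * A - l by rewrite mulrBr mulKf.
    by rewrite E opprB.
  rewrite normrN normrM normfV mulrC ltr_pdivrMr ?normr_gt0//.
  apply: le_lt_trans (hf h) _.
  have hC : `|h| < e / (`|C| + 1).
    near: h; apply: dnbhs0_lt; apply: divr_gt0 => //; exact: ltr_wpDl.
  have hp : 0 < `|h| by rewrite normr_gt0.
  rewrite -[h ^+ 2]real_normK ?num_real// expr2 mulrA ltr_pM2r//.
  apply: (@le_lt_trans _ _ (`|C| * `|h|)); first by rewrite ler_wpM2r// ler_norm.
  move: hC; rewrite ltr_pdivlMr ?ltr_wpDl// mulrDr mulr1 mulrC.
  by apply: le_lt_trans; rewrite lerDl.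
apply: DeriveDef; first by apply/cvg_ex; exists l.
exact: cvg_lim h.
Unshelve. all: by end_near.
Qed.

Definition posp (t : R) : R := (t + `|t|) / 2.

Lemma pospE t : posp t = if 0 <= t then t else 0.
Proof. rewrite /posp; case: ifPn => h; first by rewrite ger0_norm//; lra.
by rewrite ltr0_norm ?ltNge// subrr mul0r. Qed.

Lemma posp_ge0 t : 0 <= posp t.
Proof. by rewrite pospE; case: ifPn. Qed.

Lemma posp_le0 t : t <= 0 -> posp t = 0.
Proof. by move=> t0; rewrite pospE; case: ifPn => // t1; apply/eqP; rewrite eq_le t0. Qed.

Lemma ler_posp t : t <= posp t.
Proof. by rewrite pospE; case: (lerP 0 t) => // /ltW. Qed.

Lemma is_derive_posp_sq x : is_derive x (1 : R) (fun t => posp t ^+ 2) (2 * posp x).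
Proof.
apply: (@is_derive_quadratic _ _ _ 1) => h; rewrite !pospE mul1r ler_norml.
by case: (lerP 0 x) => hx; case: (lerP 0 (x + h)) => hxh; rewrite !expr2; apply/andP; split; nra.
Qed.

Lemma continuous_posp : continuous posp.
Proof.
move=> t; apply: cvgM; last exact: cvg_cst.
by apply: cvgD; [exact: cvg_id|apply: cvg_norm; exact: cvg_id].
Qed.

(** A cut-off that is only C^1, which suffices for continuous first derivatives in the plane: 1 for
    [|s| <= 1], 0 for [|s| >= 2]. Squared positive parts keep its derivative explicit. *)
Definition eta (s : R) : R := posp (1 - posp (s * s - 1) ^+ 2) ^+ 2.
Definition eta1 (s : R) : R :=
  - (2 * posp (1 - posp (s * s - 1) ^+ 2) * (2 * posp (s * s - 1) * (2 * s))).

Lemma is_derive_eta s : is_derive s (1 : R) eta (eta1 s).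
Proof.
have D0 : is_derive s (1 : R) (fun t => t * t - 1) (2 * s).
  have D := is_derive_id s (1 : R).
  apply: is_derive_eq (is_deriveBf (is_deriveMf D D) (is_derive_cst (1 : R) s (1 : R))) _.
  by ring.
have D1 := @is_derive_compf _ _ (fun t => t * t - 1) _ _ _ (is_derive_posp_sq _) D0.
have D2 := is_deriveBf (is_derive_cst (1 : R) s (1 : R)) D1.
have D3 := @is_derive_compf _ _ (fun t => 1 - posp (t * t - 1) ^+ 2) _ _ _ (is_derive_posp_sq _) D2.
by apply: is_derive_eq D3 _; rewrite /eta1; ring.
Qed.

Lemma continuous_eta : continuous eta.
Proof.
move=> s; apply: differentiable_continuous; apply/derivable1_diffP.
exact: is_derive_derivable (is_derive_eta s).
Qed.

Lemma continuous_eta1 : continuous eta1.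
Proof.
have c0 : continuous (fun s : R => posp (s * s - 1)).
  move=> s; apply: (@continuous_comp _ _ _ (fun s : R => s * s - 1) posp); last exact: continuous_posp.
  by apply: cvgB; [apply: cvgM; exact: cvg_id|exact: cvg_cst].
have c1 : continuous (fun s : R => posp (1 - posp (s * s - 1) ^+ 2)).
  move=> s; apply: (@continuous_comp _ _ _ (fun s : R => 1 - posp (s * s - 1) ^+ 2) posp); last exact: continuous_posp.
  by apply: cvgB; [exact: cvg_cst|apply: cvgM; exact: c0].
move=> s; apply: cvgN; apply: cvgM; apply: cvgM; first exact: cvg_cst.
- exact: c1.
- by apply: cvgM; [exact: cvg_cst|exact: c0].
- by apply: cvgM; [exact: cvg_cst|exact: cvg_id].
Qed.

Lemma eta_near s : `|s| <= 1 -> eta s = 1 /\ eta1 s = 0.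
Proof.
move=> s1; rewrite /eta /eta1 (@posp_le0 (s * s - 1)); last first.
  by rewrite subr_le0 -expr2 -[s ^+ 2]real_normK ?num_real// expr_le1.
by rewrite expr0n/= subr0 pospE ler01 expr1n; split => //; ring.
Qed.

Lemma eta_far s : 2 <= `|s| -> eta s = 0 /\ eta1 s = 0.
Proof.
move=> s1; rewrite /eta /eta1 (@posp_le0 (1 - _)).
  by rewrite expr0n/= mulr0 mul0r oppr0.
have := ler_posp (s * s - 1); rewrite -{1}expr2 -{1}[s ^+ 2]real_normK ?num_real//.
move=> qs; have := @ler_pM R 2 `|s| 2 `|s| (ler0n _ 2) (ler0n _ 2) s1 s1; rewrite -expr2 => s4.
have q3 : 3 <= posp (s * s - 1) by lra.
by have := @ler_pM R 3 _ 3 _ (ler0n _ 3) (ler0n _ 3) q3 q3; rewrite expr2; lra.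
Qed.

Lemma eta_bounds s : [/\ 0 <= eta s, eta s <= 1 & `|eta1 s| <= 16].
Proof.
have q0 := posp_ge0 (s * s - 1); have qs := ler_posp (s * s - 1).
have p0 := posp_ge0 (1 - posp (s * s - 1) ^+ 2).
have p1 : posp (1 - posp (s * s - 1) ^+ 2) <= 1.
  by rewrite pospE; case: ifPn => // _; rewrite gerBl sqr_ge0.
split; rewrite /eta /eta1.
- exact: sqr_ge0.
- by rewrite expr_le1.
set q := posp (s * s - 1) in q0 qs p0 p1 *.
(* For [q > 1] the outer positive part vanishes. Otherwise [s^2 <= 2], hence [|s| <= 2], and the
   derivative is [8 * p * q * |s|] in size with [p] and [q] at most 1. *)
have [q1|q1] := lerP q 1; last first.
  by rewrite (@posp_le0 (1 - _)) ?mulr0 ?mul0r ?oppr0 ?normr0// subr_le0 expr_ge1// ltW.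
have s2 : `|s| <= 2.
  have : s * s <= 2 * 2 by lra.
  by rewrite -!expr2 -[s ^+ 2]real_normK ?num_real// ler_sqr ?nnegrE.
rewrite (_ : - _ = - (8 * (posp (1 - q ^+ 2) * q * s))); last by ring.
rewrite normrN normrM [`|8|]ger0_norm// normrM (ger0_norm (mulr_ge0 p0 q0)).
have h1 : posp (1 - q ^+ 2) * q <= 1 * 1 by apply: ler_pM.
have h2 : posp (1 - q ^+ 2) * q * `|s| <= 1 * 1 * 2 by apply: ler_pM => //; exact: mulr_ge0.
lra.
Qed.

End Cutoff.

(** * The lacunary recursion on the line *)

(** The bound on [b] yields [kappa <= eps / 512], which the error budget of the Bellman step needs;
    the bound on [eps] absorbs total constants up to 200 in front of [eps * d]. *)
Definition admissible (R : realType) (b : nat) (eps : R) : Prop :=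
  [/\ 64 * 64 <= b%:R :> R, 0 < eps & eps <= 1 / 200].

Section Line.
Variables (R : realType) (b : nat) (eps : R).
Hypothesis adm : admissible b eps.

Lemma b_large : 64 * 64 <= b%:R :> R. Proof. by have [] := adm. Qed.
Lemma eps_gt0 : 0 < eps. Proof. by have [] := adm. Qed.
Lemma eps_small : eps <= 1 / 200. Proof. by have [] := adm. Qed.

Lemma eps2_gt0 : 0 < 1 - 2 * eps.
Proof. by move: eps_gt0 eps_small; lra. Qed.

Lemma b_ge100 : 100 <= b%:R :> R.
Proof. by apply: le_trans b_large; lra. Qed.

Lemma b_gt0 : 0 < b%:R :> R.
Proof. by apply: lt_le_trans b_ge100. Qed.

Definition om (n : nat) : R := 2 * pi * b%:R ^+ n.

Fixpoint u (n : nat) : R -> R :=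
  if n is m.+1 then fun x => u m x + eps / om m * (derive1 (u m) x * cos (om m * x)) else id.

Definition d (n : nat) : R -> R := derive1 (u n).
Definition Du (n : nat) (x : R) : R := eps / om n * (d n x * cos (om n * x)).
Definition Dv (n : nat) (x : R) : R := eps / om n * (d n x * sin (om n * x)).

Fixpoint v (n : nat) : R -> R := if n is m.+1 then fun x => v m x + Dv m x else cst 0.

(** The size of [d1 n] and [w1 n] relative to [om n * d n]. It carries the factor [1 / b] because
    the fastest oscillation inside [d n] is that of the previous level, [om n / b]; so [d n] and
    [w n] vary little, relative to [d n], over one period of level [n]. *)
Definition kappa : R := 8 * eps / b%:R.

Lemma om_gt0 n : 0 < om n.
Proof.
by rewrite /om mulr_gt0 ?mulr_gt0 ?pi_gt0// exprn_gt0// b_gt0.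
Qed.

Lemma omS n : om n.+1 = b%:R * om n.
Proof. by rewrite /om exprS; ring. Qed.

(** Positivity belongs to the same induction, as [d n] is its own weight: [|Du1 n| <= 2 * eps * d n]
    keeps [d n.+1] above [(1 - 2 * eps) * d n], and this allows bounds in terms of [d n] to be
    restated in terms of [d n.+1]. *)
Lemma line_invariant n :
  [/\ forall x, derivable (u n) x 1, forall x, 0 < d n x &
      forall k, deriv_bound k (om n) (d n) (d n)].
Proof.
elim: n => [|n [du dpos db]].
  have D x : is_derive x (1 : R) (u 0) 1 by exact: is_derive_id.
  have E : d 0 = cst 1 by rewrite /d (derive1_eq D).
  rewrite E; split; [by move=> x; exact: is_derive_derivable (D x)|by []|].
  move=> k; apply: (@deriv_bound_le _ _ 0 (om 0) (cst 1)) => //; first exact/ltW/om_gt0.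
  have [+ _] := @deriv_bound_trig R k 0 (lexx 0).
  by rewrite (_ : (fun _ => _) = cst 1)//; apply/funext => x; rewrite mul0r cos0.
have om0 := om_gt0 n.
have hD k : deriv_bound k (2 * om n) (fun x => eps / om n * d n x) (Du n).
  by apply: (deriv_bound_osc _ om0 (db k)).1; have e0 := eps_gt0; nneg.
have [_ [dDu _]] := hD 1%N.
have D x := is_deriveDf (derivable_is_derive (du x)) (derivable_is_derive (dDu x)).
have E : d n.+1 = (fun x => d n x + derive1 (Du n) x) by exact: derive1_eq D.
have hr k : deriv_bound k (2 * om n) (fun x => 2 * eps * d n x) (derive1 (Du n)).
  have [_ [_ +]] := hD k.+1.
  rewrite (_ : (fun x => _ * (_ * _)) = (fun x => 2 * eps * d n x))//.
  by apply/funext => x; field; rewrite gt_eqF.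
have lo x : (1 - 2 * eps) * d n x <= d n.+1 x.
  by have := deriv_bound0 (hr 0%N) x; rewrite E => /ler_normlP[]; lra.
have pos x : 0 < d n.+1 x.
  by apply: lt_le_trans (lo x); rewrite mulr_gt0 ?dpos// eps2_gt0.
split; [by move=> x; exact: is_derive_derivable (D x)|by []|].
case=> [|k]; first by split=> // x; rewrite gtr0_norm.
split; first by move=> x; rewrite gtr0_norm.
have [_ [dd db']] := db k.+1; have [_ [dr dr']] := hr k.+1.
have D' x := is_deriveDf (derivable_is_derive (dd x)) (derivable_is_derive (dr x)).
rewrite [X in forall x, derivable X _ _]E.
split; first by move=> x; exact: is_derive_derivable (D' x).
rewrite [X in (derive1 X)]E (derive1_eq D').
have b100 := b_ge100; have e0 := eps_gt0; have e1 := eps_small.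
have b2 : 2 <= b%:R :> R by lra.
(* The frequency gap pays for the change of weight: [(1 + 4 * eps) * om n * d n <= b * om n * d
   n.+1] is needed, and [b >= 100] leaves a margin [99 - 204 * eps]. *)
apply: (@deriv_bound_le _ _ (2 * om n) _ (fun x => om n * d n x + 2 * om n * (2 * eps * d n x))).
- by rewrite mulr_ge0 ?ltW.
- by rewrite omS ler_wpM2r// ltW.
- move=> x; rewrite omS.
  apply: (@le_trans _ _ (100 * om n * ((1 - 2 * eps) * d n x))).
    rewrite -subr_ge0 (_ : _ - _ = om n * d n x * (99 - 204 * eps)); last by ring.
    have e2 : 0 <= 99 - 204 * eps by lra.
    by rewrite mulr_ge0// mulr_ge0//; exact/ltW.
  have e2 := ltW eps2_gt0.
  apply: ler_pM; [|exact/mulr_ge0/ltW/dpos| |exact: lo]; last by rewrite ler_wpM2r// ltW.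
  by rewrite mulr_ge0//; exact/ltW.
- apply: deriv_boundD; last exact: dr'.
  apply: (@deriv_bound_le _ _ (om n) _ (fun x => om n * d n x)); [exact: ltW| |by []|exact: db'].
  by rewrite ler_peMl ?ler1n// ltW.
Qed.

Lemma derivable_u n x : derivable (u n) x 1.
Proof. by have [h _ _] := line_invariant n. Qed.

Lemma d_gt0 n x : 0 < d n x.
Proof. by have [_ h _] := line_invariant n. Qed.

Lemma Du_deriv_bound k n : deriv_bound k (2 * om n) (fun x => eps / om n * d n x) (Du n).
Proof.
have [_ _ h] := line_invariant n; have om0 := om_gt0 n.
by apply: (deriv_bound_osc _ om0 (h k)).1; have e0 := eps_gt0; nneg.
Qed.

Lemma Dv_deriv_bound k n : deriv_bound k (2 * om n) (fun x => eps / om n * d n x) (Dv n).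
Proof.
have [_ _ h] := line_invariant n; have om0 := om_gt0 n.
by apply: (deriv_bound_osc _ om0 (h k)).2; have e0 := eps_gt0; nneg.
Qed.

Definition Du1 n := derive1 (Du n).
Definition Du2 n := derive1 (Du1 n).
Definition Dv1 n := derive1 (Dv n).
Definition Dv2 n := derive1 (Dv1 n).
Definition w n := derive1 (v n).
Definition d1 n := derive1 (d n).
Definition w1 n := derive1 (w n).

Lemma osc_bounds n (D : R -> R) :
  (forall k, deriv_bound k (2 * om n) (fun x => eps / om n * d n x) D) ->
  [/\ forall x, `|D x| <= eps / om n * d n x,
      forall x, `|derive1 D x| <= 2 * eps * d n x &
      forall x, `|derive1 (derive1 D) x| <= 4 * eps * om n * d n x] /\
  [/\ forall x, is_derive x (1 : R) D (derive1 D x),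
      forall x, is_derive x (1 : R) (derive1 D) (derive1 (derive1 D) x) &
      continuous (derive1 (derive1 D))].
Proof.
move=> h; have om0 := om_gt0 n.
have [h0 [dD [h1 [dD1 [h2 [dD2 _]]]]]] := h 3%N.
split; split; [exact: h0| | | | |].
- move=> x; apply: le_trans (h1 x) _; rewrite le_eqVlt; apply/orP; left; apply/eqP.
  by field; rewrite gt_eqF.
- move=> x; apply: le_trans (h2 x) _; rewrite le_eqVlt; apply/orP; left; apply/eqP.
  by field; rewrite gt_eqF.
- by move=> x; apply: derivable_is_derive; exact: dD.
- by move=> x; apply: derivable_is_derive; exact: dD1.
- by move=> x; apply: differentiable_continuous; exact/derivable1_diffP.
Qed.

Lemma Du_bounds n :
  [/\ forall x, `|Du n x| <= eps / om n * d n x,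
      forall x, `|Du1 n x| <= 2 * eps * d n x &
      forall x, `|Du2 n x| <= 4 * eps * om n * d n x].
Proof. by have [] := osc_bounds (Du_deriv_bound^~ n). Qed.

Lemma Dv_bounds n :
  [/\ forall x, `|Dv n x| <= eps / om n * d n x,
      forall x, `|Dv1 n x| <= 2 * eps * d n x &
      forall x, `|Dv2 n x| <= 4 * eps * om n * d n x].
Proof. by have [] := osc_bounds (Dv_deriv_bound^~ n). Qed.

Lemma Du_derive n :
  [/\ forall x, is_derive x (1 : R) (Du n) (Du1 n x),
      forall x, is_derive x (1 : R) (Du1 n) (Du2 n x) & continuous (Du2 n)].
Proof. by have [] := osc_bounds (Du_deriv_bound^~ n). Qed.

Lemma Dv_derive n :
  [/\ forall x, is_derive x (1 : R) (Dv n) (Dv1 n x),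
      forall x, is_derive x (1 : R) (Dv1 n) (Dv2 n x) & continuous (Dv2 n)].
Proof. by have [] := osc_bounds (Dv_deriv_bound^~ n). Qed.

Lemma is_derive_u n x : is_derive x (1 : R) (u n) (d n x).
Proof. by apply: derivable_is_derive; exact: derivable_u. Qed.

Lemma dS n x : d n.+1 x = d n x + Du1 n x.
Proof.
have [h _ _] := Du_derive n.
have D y := is_deriveDf (is_derive_u n y) (h y).
by rewrite /d (derive1_eq D).
Qed.

Lemma is_derive_d n x : is_derive x (1 : R) (d n) (d1 n x).
Proof.
have [_ _ h] := line_invariant n; have [_ [dd _]] := h 1%N.
exact: derivable_is_derive.
Qed.

Lemma d1S n x : d1 n.+1 x = d1 n x + Du2 n x.
Proof.
have [_ h _] := Du_derive n.
have D y := is_deriveDf (is_derive_d n y) (h y).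
rewrite /d1 (_ : d n.+1 = fun x => d n x + Du1 n x) ?(derive1_eq D)//.
by apply/funext => y; exact: dS.
Qed.

Lemma is_derive_v n x : is_derive x (1 : R) (v n) (w n x).
Proof.
elim: n x => [|n IH] x.
  by have D y : is_derive y (1 : R) (v 0) 0; [exact: is_derive_cst|rewrite /w (derive1_eq D)].
have [h _ _] := Dv_derive n.
have D y := is_deriveDf (IH y) (h y).
by rewrite /w (derive1_eq D).
Qed.

Lemma w0 x : w 0 x = 0.
Proof. by have D y : is_derive y (1 : R) (v 0) 0; [exact: is_derive_cst|rewrite /w (derive1_eq D)]. Qed.

Lemma wS n x : w n.+1 x = w n x + Dv1 n x.
Proof.
have [h _ _] := Dv_derive n.
have D y := is_deriveDf (is_derive_v n y) (h y).
by rewrite /w (derive1_eq D).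
Qed.

Lemma is_derive_w n x : is_derive x (1 : R) (w n) (w1 n x).
Proof.
elim: n x => [|n IH] x.
  rewrite /w1 (_ : w 0 = cst 0); last by apply/funext => y; exact: w0.
  by have D y : is_derive y (1 : R) (cst 0 : R -> R) 0; [exact: is_derive_cst|rewrite (derive1_eq D)].
have [_ h _] := Dv_derive n.
have D y := is_deriveDf (IH y) (h y).
rewrite /w1 (_ : w n.+1 = fun x => w n x + Dv1 n x) ?(derive1_eq D)//.
by apply/funext => y; exact: wS.
Qed.

Lemma w1S n x : w1 n.+1 x = w1 n x + Dv2 n x.
Proof.
have [_ h _] := Dv_derive n.
have D y := is_deriveDf (is_derive_w n y) (h y).
rewrite /w1 (_ : w n.+1 = fun x => w n x + Dv1 n x) ?(derive1_eq D)//.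
by apply/funext => y; exact: wS.
Qed.

Lemma d0 x : d 0 x = 1.
Proof. by have D y : is_derive y (1 : R) (u 0) 1; [exact: is_derive_id|rewrite /d (derive1_eq D)]. Qed.

Lemma d10 x : d1 0 x = 0.
Proof.
rewrite /d1 (_ : d 0 = cst 1); last by apply/funext => y; exact: d0.
by have D y : is_derive y (1 : R) (cst 1 : R -> R) 0; [exact: is_derive_cst|rewrite (derive1_eq D)].
Qed.

Lemma w10 x : w1 0 x = 0.
Proof.
rewrite /w1 (_ : w 0 = cst 0); last by apply/funext => y; exact: w0.
by have D y : is_derive y (1 : R) (cst 0 : R -> R) 0; [exact: is_derive_cst|rewrite (derive1_eq D)].
Qed.

Lemma d_step n x : (1 - 2 * eps) * d n x <= d n.+1 x <= (1 + 2 * eps) * d n x.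
Proof. by have [_ /(_ x)/ler_normlP[] + + _] := Du_bounds n; rewrite dS; lra. Qed.

Lemma kappa_gt0 : 0 < kappa.
Proof. by rewrite /kappa divr_gt0 ?b_gt0// mulr_gt0 ?eps_gt0. Qed.

Lemma kappa_b : kappa * b%:R = 8 * eps.
Proof. by rewrite /kappa divfK// gt_eqF// b_gt0. Qed.

Lemma kappa_le : kappa <= eps / (64 * 8).
Proof.
rewrite /kappa ler_pdivrMr ?b_gt0//.
apply: (@le_trans _ _ (eps / (64 * 8) * (64 * 64))); last first.
  by apply: ler_wpM2l; [have e0 := eps_gt0; nneg|exact: b_large].
by rewrite le_eqVlt; apply/orP; left; apply/eqP; field.
Qed.

(** Since [kappa * om n.+1 = 8 * eps * om n], the new term takes [4 * eps], half of the budget; the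
    inherited [kappa] and the loss [1 - 2 * eps] fit in the other half. *)
Lemma second_deriv_step (g g' : R) n x :
  `|g| <= kappa * om n * d n x -> `|g'| <= 4 * eps * om n * d n x ->
  `|g + g'| <= kappa * om n.+1 * d n.+1 x.
Proof.
move=> h h'; apply: le_trans (ler_normD _ _) _; apply: le_trans (lerD h h') _.
rewrite omS mulrA kappa_b.
have /andP[lo _] := d_step n x.
have e0 := eps_gt0; have e1 := eps_small; have k := kappa_le.
have om0 := om_gt0 n; have dp := d_gt0 n x.
apply: (@le_trans _ _ (8 * eps * om n * ((1 - 2 * eps) * d n x))); last first.
  by apply: ler_wpM2l; [nneg|exact: lo].
rewrite -subr_ge0 (_ : _ - _ = (4 * eps - kappa - 16 * eps * eps) * (om n * d n x)); last by ring.
apply: mulr_ge0; last by apply: mulr_ge0; exact: ltW.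
have : eps * eps <= eps * (1 / 200) by rewrite ler_wpM2l// ltW.
lra.
Qed.

Lemma d1_bound n x : `|d1 n x| <= kappa * om n * d n x.
Proof.
elim: n => [|n IH].
  by rewrite d10 normr0; have k0 := kappa_gt0; have o0 := om_gt0 0; have p0 := d_gt0 0 x; nneg.
by rewrite d1S; apply: second_deriv_step => //; have [_ _] := Du_bounds n.
Qed.

Lemma w1_bound n x : `|w1 n x| <= kappa * om n * d n x.
Proof.
elim: n => [|n IH].
  by rewrite w10 normr0; have k0 := kappa_gt0; have o0 := om_gt0 0; have p0 := d_gt0 0 x; nneg.
by rewrite w1S; apply: second_deriv_step => //; have [_ _] := Dv_bounds n.
Qed.

Lemma d_le_pow2 n x : d n x <= 2 ^+ n.
Proof.
elim: n => [|n IH]; first by rewrite d0 expr0.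
have /andP[_ hi] := d_step n x; rewrite exprS; apply: le_trans hi _.
have e0 := eps_gt0; have e1 := eps_small.
by apply: ler_pM => //; [lra|exact/ltW/d_gt0|lra].
Qed.

Lemma Du1E n x : Du1 n x = eps * (- d n x * sin (om n * x) + d1 n x / om n * cos (om n * x)).
Proof.
have om0 := om_gt0 n.
have D y := is_deriveCf (eps / om n) (is_deriveMf (is_derive_d n y) (is_derive_cos_lin (om n) y)).
by rewrite /Du1 (derive1_eq D); field; rewrite gt_eqF.
Qed.

Lemma Dv1E n x : Dv1 n x = eps * (d n x * cos (om n * x) + d1 n x / om n * sin (om n * x)).
Proof.
have om0 := om_gt0 n.
have D y := is_deriveCf (eps / om n) (is_deriveMf (is_derive_d n y) (is_derive_sin_lin (om n) y)).
by rewrite /Dv1 (derive1_eq D); field; rewrite gt_eqF.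
Qed.

(** * The Bellman function and its gain in one step *)

Section Bellman.
Variable n : nat.

Definition slope (x : R) : R := w n x / d n x.
(* The antiderivative [beta] of [atan] makes [(d, w) |-> d * beta (w / d)] a convex,
   1-homogeneous minorant of [2 |w|], used as a Bellman function. *)
Definition bell (x : R) : R := d n x * beta (slope x).
Definition slope1 (x : R) : R := (w1 n x * d n x - w n x * d1 n x) / d n x ^+ 2.
(* The first line is the first-order variation of [bell] with [Dv], [Du] in place of
   their derivatives; the second one compensates the oscillating part
   [cos (2 (om x - atan slope))] of the second-order gain. *)
Definition corr (x : R) : R :=
  atan (slope x) * Dv n x - ln (1 + slope x ^+ 2) / 2 * Du n x +
  eps ^+ 2 / (64 * om n) * (d n x * sin (2 * (om n * x - atan (slope x)))).
Definition corr1 (x : R) : R :=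
  (atan (slope x) * Dv1 n x + slope1 x / (1 + slope x ^+ 2) * Dv n x)
  - (ln (1 + slope x ^+ 2) / 2 * Du1 n x + slope x * (slope1 x / (1 + slope x ^+ 2)) * Du n x) +
  eps ^+ 2 / (64 * om n) * (d n x * (2 * (om n - slope1 x / (1 + slope x ^+ 2)) *
     cos (2 * (om n * x - atan (slope x)))) + d1 n x * sin (2 * (om n * x - atan (slope x)))).

Lemma is_derive_slope x : is_derive x (1 : R) slope (slope1 x).
Proof.
have p := d_gt0 n x.
have D1 : is_derive (d n x) (1 : R) (fun y : R => y^-1) (- (d n x) ^- 2).
  by apply: is_derive_eq (is_deriveV _ _) _; rewrite ?gt_eqF// /GRing.scale/= mulr1.
have D2 := is_deriveMf (is_derive_w n x) (is_derive_compf D1 (is_derive_d n x)).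
by apply: is_derive_eq D2 _; rewrite /slope1; field; rewrite gt_eqF.
Qed.

Lemma is_derive_corr x : is_derive x (1 : R) corr (corr1 x).
Proof.
have [Du' _ _] := Du_derive n; have [Dv' _ _] := Dv_derive n.
have Ds := is_derive_slope x.
have Dpsi := is_deriveCf 2 (is_deriveBf (is_derive_linear (om n) x) (is_derive_atanf Ds)).
have Dsin := is_derive_compf (is_derive_sin _) Dpsi.
have h := is_deriveDf (is_deriveBf (is_deriveMf (is_derive_atanf Ds) (Dv' x))
   (is_deriveMf (is_derive_log1sq Ds) (Du' x)))
   (is_deriveCf (eps ^+ 2 / (64 * om n)) (is_deriveMf (is_derive_d n x) Dsin)).
by apply: is_derive_eq h _; rewrite /corr1; ring.
Qed.

(** These are the derivatives of [atan slope] and of [ln (1 + slope^2) / 2]. Over the common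
    denominator [d^2 + w^2] the numerators are quadratic in [(d, w)] up to the factor
    [kappa * om n], so large slopes do no harm. *)
Lemma slope1_bounds x :
  `|slope1 x / (1 + slope x ^+ 2)| <= 2 * kappa * om n /\
  `|slope x * (slope1 x / (1 + slope x ^+ 2))| <= 2 * kappa * om n.
Proof.
have p := d_gt0 n x; have o := om_gt0 n; have k := kappa_gt0.
have hd := d1_bound n x; have hw := w1_bound n x.
set D : R := d n x in p hd hw *; set W : R := w n x; set A1 : R := d1 n x in hd *; set A2 : R := w1 n x in hw *.
have q : 0 < D ^+ 2 + W ^+ 2 by rewrite ltr_pwDl ?exprn_gt0 ?sqr_ge0.
have N : `|A2 * D - W * A1| <= kappa * om n * D * (D + `|W|).
  have gen (a a' c z : R) : `|a| <= c -> `|a'| <= c -> `|a * D - z * a'| <= c * (D + `|z|).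
    move=> ha ha'; apply: le_trans (ler_normB _ _) _; rewrite !normrM (gtr0_norm p) [`|z| * _]mulrC mulrDr.
    exact: lerD (ler_wpM2r (ltW p) ha) (ler_wpM2r (normr_ge0 z) ha').
  exact: (gen _ _ _ _ hw hd).
have sq : `|W| ^+ 2 = W ^+ 2 by rewrite real_normK ?num_real.
have E1 : slope1 x / (1 + slope x ^+ 2) = (A2 * D - W * A1) / (D ^+ 2 + W ^+ 2).
  rewrite /slope1 /slope -/D -/W -/A1 -/A2; field.
  by rewrite !gt_eqF//= addrC.
have aux (A : R) : A <= 2 * kappa * om n * (D ^+ 2 + W ^+ 2) -> A / (D ^+ 2 + W ^+ 2) <= 2 * kappa * om n.
  by move=> h; rewrite ler_pdivrMr.
have DW : D * `|W| <= D ^+ 2 + W ^+ 2 by rewrite -sq; apply: mul_le_sumsq; nneg.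
have ko : 0 <= kappa * om n by nneg.
split.
- rewrite E1 normrM [X in _ * X]gtr0_norm ?invr_gt0//; apply: aux; apply: le_trans N _.
  rewrite -subr_ge0 (_ : _ - _ = kappa * om n * ((D ^+ 2 + W ^+ 2 - D * `|W|) + W ^+ 2)); last by ring.
  by apply: mulr_ge0 => //; apply: addr_ge0; [rewrite subr_ge0|exact: sqr_ge0].
- rewrite E1 mulrA normrM [X in _ * X]gtr0_norm ?invr_gt0//; apply: aux.
  rewrite normrM /slope -/D -/W normrM normfV (gtr0_norm p).
  apply: (@le_trans _ _ (`|W| / D * (kappa * om n * D * (D + `|W|)))).
    by apply: ler_wpM2l => //; nneg.
  rewrite (_ : _ / _ * _ = kappa * om n * (D * `|W| + W ^+ 2)); last first.
    by rewrite -sq; field; rewrite gt_eqF.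
  rewrite -subr_ge0 (_ : _ - _ = kappa * om n * ((D ^+ 2 + W ^+ 2 - D * `|W|) + D ^+ 2)); last by ring.
  by apply: mulr_ge0 => //; apply: addr_ge0; [rewrite subr_ge0|exact: sqr_ge0].
Qed.

(** The quantity on the left is [d n.+1] times the jump of the slope; the bound brings that jump
    into the range of [beta_bregman]. *)
Lemma tilt_bound x : `|Dv1 n x - slope x * Du1 n x| <= 4 * eps * d n x * (1 + `|slope x|).
Proof.
have [_ hu _] := Du_bounds n; have [_ hv _] := Dv_bounds n.
have e0 := eps_gt0; have p := d_gt0 n x.
apply: le_trans (ler_normB _ _) _; rewrite normrM.
have := ler_wpM2l (normr_ge0 (slope x)) (hu x); have := hv x.
have := mulr_ge0 (mulr_ge0 (ltW e0) (ltW p)) (normr_ge0 (slope x)).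
have := mulr_ge0 (ltW e0) (ltW p); lra.
Qed.

(** The leading part is [eps * d * (cos th + S * sin th)], squared through [cos_sub_atan]. The part
    containing [d1] is split off by [(a + c)^2 >= a^2 / 2 - c^2], whence the factor 1/2 and the loss
    [kappa^2]. *)
Lemma tilt_sq x : eps ^+ 2 * d n x ^+ 2 * (1 + slope x ^+ 2) *
    (cos (om n * x - atan (slope x)) ^+ 2 / 2 - kappa ^+ 2)
  <= (Dv1 n x - slope x * Du1 n x) ^+ 2.
Proof.
have e0 := eps_gt0; have p := d_gt0 n x; have o := om_gt0 n.
rewrite Dv1E Du1E; set S := slope x; set th := om n * x; set q := d1 n x / om n.
have hq : `|q| <= kappa * d n x.
  rewrite /q normrM normfV (gtr0_norm o) ler_pdivrMr//.
  by rewrite mulrAC; exact: d1_bound.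
set D := d n x in p hq *.
have q2 : q ^+ 2 <= kappa ^+ 2 * D ^+ 2.
  rewrite -exprMn -[q ^+ 2]real_normK ?num_real// lerXn2r// nnegrE//.
  by have k := kappa_gt0; nneg.
have cs : cos th ^+ 2 + sin th ^+ 2 = 1 by rewrite cos2Dsin2.
have C := cos_sub_atan th S.
(* A rotation of [(1, S)] gives [A^2 + Bq^2 = 1 + S^2], which bounds the coefficient [Bq] of the
   error. *)
set A := cos th + S * sin th in C; set Bq := sin th - S * cos th.
have AB : Bq ^+ 2 <= 1 + S ^+ 2.
  rewrite -subr_ge0 (_ : _ - _ = A ^+ 2); first exact: sqr_ge0.
  transitivity ((1 + S ^+ 2) * (cos th ^+ 2 + sin th ^+ 2) - Bq ^+ 2); first by rewrite cs mulr1.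
  by rewrite /A /Bq; ring.
rewrite (_ : (_ - _) ^+ 2 = eps ^+ 2 * (D * A + q * Bq) ^+ 2); last by rewrite /A /Bq; ring.
rewrite (_ : _ * _ * _ * _ = eps ^+ 2 * (D ^+ 2 * (cos (th - atan S) ^+ 2 * (1 + S ^+ 2)) / 2 -
   kappa ^+ 2 * D ^+ 2 * (1 + S ^+ 2))); last by ring.
rewrite C; apply: ler_wpM2l; first exact: sqr_ge0.
have : q ^+ 2 * Bq ^+ 2 <= kappa ^+ 2 * D ^+ 2 * (1 + S ^+ 2).
  by apply: ler_pM => //; exact: sqr_ge0.
have := sqr_ge0 (D * A + 2 * (q * Bq)); rewrite !expr2; lra.
Qed.

End Bellman.

(** Subtracting the first-order term from the increment of [d * beta (w / d)] leaves exactly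
    [d n.+1] times the Bregman remainder of [beta] between the two slopes. *)
Lemma bell_bregman n x : (Dv1 n x - slope n x * Du1 n x) ^+ 2 / (8 * d n x * (1 + slope n x ^+ 2))
  <= bell n.+1 x - bell n x - (atan (slope n x) * Dv1 n x - ln (1 + slope n x ^+ 2) / 2 * Du1 n x).
Proof.
have e0 := eps_gt0; have e1 := eps_small; have p := d_gt0 n x; have p1 := d_gt0 n.+1 x.
have /andP[lo hi] := d_step n x.
have gen (D D' : R) : 0 < D -> (1 - 2 * eps) * D <= D' -> D' <= (1 + 2 * eps) * D ->
    0 <= D' / 5 - 4 * eps * D /\ 0 <= 8 * D - 4 * D'.
  move=> D0 h h'; have := ler_wpM2r (ltW D0) e1; lra.
set S := slope n x; set T := Dv1 n x - S * Du1 n x.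
have S0 : 0 < 1 + S ^+ 2 by rewrite ltr_wpDr ?sqr_ge0.
have W : w n x = S * d n x by rewrite /S /slope divfK// gt_eqF.
have ES : slope n.+1 x = S + T / d n.+1 x.
  by rewrite /slope /T wS W -[d n.+1 x]/(d n.+1 x); rewrite dS; field; rewrite -dS gt_eqF.
have E : bell n.+1 x - bell n x - (atan S * Dv1 n x - ln (1 + S ^+ 2) / 2 * Du1 n x) =
    d n.+1 x * (beta (S + T / d n.+1 x) - beta S - atan S * (T / d n.+1 x)).
  have -> : d n.+1 x * (beta (S + T / d n.+1 x) - beta S - atan S * (T / d n.+1 x)) =
     d n.+1 x * beta (S + T / d n.+1 x) - d n.+1 x * beta S - atan S * T.
    by field; rewrite gt_eqF.
  by rewrite /bell ES -/S dS /T /beta; ring.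
have Tb : `|T / d n.+1 x| <= (1 + `|S|) / 5.
  rewrite normrM normfV (gtr0_norm p1) ler_pdivrMr//.
  apply: le_trans (tilt_bound n x) _; rewrite -/S.
  rewrite -subr_ge0.
  have h : 0 <= d n.+1 x / 5 - 4 * eps * d n x by exact: (gen _ _ p lo hi).1.
  rewrite (_ : _ - _ = (1 + `|S|) * (d n.+1 x / 5 - 4 * eps * d n x)); last by ring.
  by apply: mulr_ge0 => //; nneg.
rewrite E; have := ler_wpM2l (ltW p1) (beta_bregman Tb); apply: le_trans.
rewrite (_ : d n.+1 x * _ = T ^+ 2 / (4 * d n.+1 x * (1 + S ^+ 2))); last first.
  by field; rewrite !gt_eqF.
apply: ler_wpM2l; first exact: sqr_ge0.
rewrite lef_pV2 ?posrE ?mulr_gt0//; apply: ler_wpM2r; first exact: ltW.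
by rewrite -subr_ge0; exact: (gen _ _ p lo hi).2.
Qed.

(** The budget in units of [X = eps^2 * D]: the mean gain is 1/32, of which 1/64 is kept. The terms
    in [C] of the gain and of the corrector cancel, and every other error carries a factor [k]. The
    largest, [4 * k * eps * D <= X / 128], is what asks for [k <= eps / 512]. *)
Lemma bell_step_arith (k o D D1 al1 S C Sn a b0 b1 l c0 c1 G : R) :
  0 < k -> k <= eps / (64 * 8) -> 0 < D -> 0 < o ->
  `|al1| <= 2 * k * o -> `|S * al1| <= 2 * k * o ->
  `|b0| <= eps / o * D -> `|c0| <= eps / o * D -> `|D1| <= k * o * D ->
  `|C| <= 1 -> `|Sn| <= 1 ->
  eps ^+ 2 * D * (1 / 32 + C / 32 - k ^+ 2 / 8) <= G - (a * b1 - l * c1) ->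
  (a * b1 + al1 * b0) - (l * c1 + S * al1 * c0) +
  eps ^+ 2 / (64 * o) * (D * (2 * (o - al1) * C) + D1 * Sn) + eps ^+ 2 / 64 * D <= G.
Proof.
have e0 := eps_gt0; have e1 := eps_small.
move=> k0 k1 p q s1 s2 hv hu hd hC hS g1.
have prodb (A B A' B' : R) : `|A| <= A' -> `|B| <= B' -> - (A' * B') <= A * B <= A' * B'.
  by move=> hA hB; rewrite -ler_norml normrM ler_pM.
have /andP[_ a1] := prodb _ _ _ _ s1 hv.
have /andP[a2 _] := prodb _ _ _ _ s2 hu.
have /andP[a3 _] := prodb _ _ _ _ s1 hC.
have /andP[_ a4] := prodb _ _ _ _ hd hS.
set X := eps ^+ 2 * D in g1 *.
have X0 : 0 <= X by apply: mulr_ge0; [exact: sqr_ge0|exact: ltW].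
have keX : k * eps * D <= X / (64 * 8).
  rewrite (_ : X / _ = eps / (64 * 8) * eps * D); last by rewrite /X; field.
  by apply: ler_wpM2r; [exact: ltW|apply: ler_wpM2r => //; exact: ltW].
have kX : X * k <= X * (1 / 100) by apply: ler_wpM2l => //; lra.
have kkX : X * k ^+ 2 <= X * (1 / 100).
  by apply: ler_wpM2l => //; rewrite expr2 -[leRHS]mulr1; apply: ler_pM; lra.
have b1' : al1 * b0 <= 2 * (k * eps * D).
  apply: le_trans a1 _; rewrite le_eqVlt; apply/orP; left; apply/eqP.
  by field; rewrite gt_eqF.
have b2' : - (2 * (k * eps * D)) <= S * al1 * c0.
  apply: le_trans a2; rewrite le_eqVlt; apply/orP; left; apply/eqP.
  by field; rewrite gt_eqF.
have b3' : eps ^+ 2 / (64 * o) * (D * (2 * (o - al1) * C) + D1 * Sn) <=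
    X * C / 32 + X * k / 16 + X * k / 64.
  rewrite (_ : eps ^+ 2 / _ * _ = X * C / 32 - X / (32 * o) * (al1 * C) +
     eps ^+ 2 / (64 * o) * (D1 * Sn)); last by rewrite /X; field; rewrite gt_eqF.
  have c1' : 0 <= X / (32 * o) by nneg.
  have c2' : 0 <= eps ^+ 2 / (64 * o) by nneg.
  apply: lerD; [apply: lerD => //|].
    have := ler_wpM2l c1' a3; rewrite mulrN.
    rewrite (_ : X / (32 * o) * (2 * k * o * 1) = X * k / 16); first lra.
    by field; rewrite gt_eqF.
  have := ler_wpM2l c2' a4.
  rewrite (_ : eps ^+ 2 / (64 * o) * (k * o * D * 1) = X * k / 64)//.
  by rewrite /X; field; rewrite gt_eqF.
rewrite (_ : eps ^+ 2 / 64 * D = X / 64); last by rewrite /X; ring.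
rewrite (_ : X * (1 / 32 + C / 32 - k ^+ 2 / 8) =
  X / 32 + X * C / 32 - X * k ^+ 2 / 8) in g1; last by ring.
move: g1 b1' b2' b3' keX kX kkX X0; clear; clearbody X; lra.
Qed.

Lemma bell_step n x : corr1 n x + eps ^+ 2 / 64 * d n x <= bell n.+1 x - bell n x.
Proof.
have e0 := eps_gt0; have e1 := eps_small; have k0 := kappa_gt0; have k1 := kappa_le.
have p := d_gt0 n x; have o := om_gt0 n.
have h1 := bell_bregman n x; have [s1 s2] := slope1_bounds n x.
have [hu _ _] := Du_bounds n; have [hv _ _] := Dv_bounds n.
have ht := tilt_sq n x.
set S := slope n x in h1 s1 s2 ht *.
have S0 : 0 < 1 + S ^+ 2 by rewrite ltr_wpDr ?sqr_ge0.
set al1 := slope1 n x / (1 + S ^+ 2) in s1 s2 *.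
rewrite /corr1 -/S -/al1.
set psi := 2 * (om n * x - atan S).
(* Doubling the angle exposes the mean 1/2 of the squared cosine; its oscillating half is matched by
   the last term of [corr1]. *)
rewrite cos_half_sq -/psi in ht.
have g1 : eps ^+ 2 * d n x * (1 / 32 + cos psi / 32 - kappa ^+ 2 / 8) <=
   (Dv1 n x - S * Du1 n x) ^+ 2 / (8 * d n x * (1 + S ^+ 2)).
  rewrite ler_pdivlMr ?mulr_gt0//; apply: le_trans ht.
  by rewrite le_eqVlt; apply/orP; left; apply/eqP; field.
have hd := d1_bound n x; have hc := cos_le1n psi; have hs := sin_le1n psi.
exact: (bell_step_arith k0 k1 p o s1 s2 (hv x) (hu x) hd hc hs (le_trans g1 h1)).
Qed.

Lemma bell0 x : bell 0 x = 0.
Proof. by rewrite /bell /slope w0 mul0r /beta mul0r expr0n/= addr0 ln1 mul0r subrr mulr0. Qed.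

Lemma bell_le n x : bell n x <= 2 * `|w n x|.
Proof.
have p := d_gt0 n x.
rewrite /bell /beta mulrBr.
apply: (@le_trans _ _ (d n x * (slope n x * atan (slope n x)))).
  rewrite gerBl; apply: mulr_ge0; first exact: ltW.
  by apply: divr_ge0 => //; apply: ln_ge0; rewrite lerDl sqr_ge0.
rewrite mulrA (_ : d n x * slope n x = w n x); last by rewrite /slope mulrCA divff ?mulr1// gt_eqF.
apply: le_trans (ler_norm _) _; rewrite normrM mulrC ler_wpM2r// ler_norml.
have := atan_gtNpi2 (slope n x); have := atan_ltpi2 (slope n x); have := @pihalf_lt2 R.
by move: (pi / 2) (atan _) => c a; lra.
Qed.

(* All of [corr] is 1-periodic and [u k (x + 1) = u k x + 1], so over a period
   [drift n] grows by exactly [n eps^2 / 64], while [drift1 n <= bell n]. *)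
Definition drift (n : nat) (x : R) : R :=
  \sum_(0 <= k < n) corr k x + eps ^+ 2 / 64 * \sum_(0 <= k < n) u k x.
Definition drift1 (n : nat) (x : R) : R :=
  \sum_(0 <= k < n) corr1 k x + eps ^+ 2 / 64 * \sum_(0 <= k < n) d k x.

Lemma is_derive_drift n x : is_derive x (1 : R) (drift n) (drift1 n x).
Proof.
apply: is_deriveDf; first by apply: is_derive_sumf => k; exact: is_derive_corr.
by apply: is_deriveCf; apply: is_derive_sumf => k; exact: is_derive_u.
Qed.

Lemma drift1_le n x : drift1 n x <= bell n x.
Proof.
rewrite /drift1; elim: n => [|n IH]; first by rewrite !big_geq// mulr0 addr0 bell0.
have gen (A B C D b0 b1 e : R) : A + e * B <= b0 -> C + e * D <= b1 - b0 -> A + C + e * (B + D) <= b1.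
  by rewrite mulrDr; lra.
by rewrite !big_nat_recr//=; exact: (gen _ _ _ _ _ _ _ IH (bell_step n x)).
Qed.

(** * Periodicity, and variation on the b-adic grid *)

Lemma omE_mulrn n : om n = pi *+ 2 *+ (b ^ n)%N.
Proof.
by rewrite /om -mulrnA -[RHS]mulr_natr natrM natrX mulrA [2 * pi]mulrC.
Qed.

Lemma cos_om n k t : cos (t + om n *+ k) = cos t.
Proof. by rewrite omE_mulrn -mulrnA; exact: (periodicn (@cosD2pi R)). Qed.

Lemma sin_om n k t : sin (t + om n *+ k) = sin t.
Proof. by rewrite omE_mulrn -mulrnA; exact: (periodicn (@sinD2pi R)). Qed.

Lemma uS n x : u n.+1 x = u n x + Du n x.
Proof. by []. Qed.

Lemma vS n x : v n.+1 x = v n x + Dv n x.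
Proof. by []. Qed.

Lemma u_shift n x : u n (x + 1) = u n x + 1.
Proof.
elim: n x => [|n IH] x //.
rewrite !uS IH /Du (derive_shift _ (is_derive_u n) IH) mulrDr mulr1.
by rewrite (cos_om n 1); ring.
Qed.

Lemma d_shift n x : d n (x + 1) = d n x.
Proof. exact: (derive_shift _ (is_derive_u n) (u_shift n)). Qed.

Lemma Du_shift n x : Du n (x + 1) = Du n x.
Proof. by rewrite /Du d_shift mulrDr mulr1 (cos_om n 1). Qed.

Lemma Dv_shift n x : Dv n (x + 1) = Dv n x.
Proof. by rewrite /Dv d_shift mulrDr mulr1 (sin_om n 1). Qed.

Lemma v_shift n x : v n (x + 1) = v n x + 0.
Proof. by elim: n x => [|n IH] x; rewrite ?addr0// !vS IH Dv_shift !addr0. Qed.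

Lemma w_shift n x : w n (x + 1) = w n x.
Proof. exact: (derive_shift _ (is_derive_v n) (v_shift n)). Qed.

Lemma corr_shift n x : corr n (x + 1) = corr n x.
Proof.
rewrite /corr Dv_shift Du_shift d_shift /slope w_shift d_shift.
rewrite (_ : 2 * (om n * (x + 1) - _) = 2 * (om n * x - atan (w n x / d n x)) + om n *+ 2).
  by rewrite sin_om.
by ring.
Qed.

Lemma drift_increment n : drift n 1 - drift n 0 = n%:R * (eps ^+ 2 / 64).
Proof.
have s1 : \sum_(0 <= k < n) corr k 1 = \sum_(0 <= k < n) corr k 0.
  by apply: eq_bigr => k _; rewrite -{1}[1]add0r corr_shift.
have s2 : \sum_(0 <= k < n) u k 1 = \sum_(0 <= k < n) u k 0 + n%:R.
  have -> : n%:R = \sum_(0 <= k < n) (1 : R) by rewrite sumr_const_nat subn0.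
  rewrite -big_split/=.
  by apply: eq_bigr => k _; rewrite -{1}[1]add0r u_shift.
by rewrite /drift s1 s2; ring.
Qed.

(** Both [kappa * om n * u n + w n] and [kappa * om n * u n - w n] are nondecreasing. Measuring the
    oscillation by increments of [u n] makes the errors of all cells add up to a multiple of
    [u n 1 - u n 0 = 1]. *)
Lemma w_osc n x y : x <= y -> `|w n x - w n y| <= kappa * om n * (u n y - u n x).
Proof.
move=> xy; have ko : 0 <= kappa * om n.
  by have k0 := kappa_gt0; have o := om_gt0 n; nneg.
have wb z : - (kappa * om n * d n z) <= w1 n z <= kappa * om n * d n z.
  by rewrite -ler_norml; exact: w1_bound.
have D1 z := is_deriveDf (is_deriveCf (kappa * om n) (is_derive_u n z)) (is_derive_w n z).
have D2 z := is_deriveBf (is_deriveCf (kappa * om n) (is_derive_u n z)) (is_derive_w n z).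
have p1 z : 0 <= kappa * om n * d n z + w1 n z by have /andP[] := wb z; lra.
have p2 z : 0 <= kappa * om n * d n z - w1 n z by have /andP[] := wb z; lra.
have := nondecreasing_derive D1 p1 xy; have := nondecreasing_derive D2 p2 xy.
rewrite ler_norml; move: (w n x) (w n y) (u n x) (u n y) => a a' c c'.
by move: (kappa * om n) => e; lra.
Qed.

Lemma u_le n x y : x <= y -> u n x <= u n y.
Proof. by apply: nondecreasing_derive (is_derive_u n) _ => z; exact/ltW/d_gt0. Qed.

(** The mean value theorem gives different points for [drift n] and [v n]. At the first,
    [drift1 <= bell <= 2 * |w|]; moving [|w|] to the second costs [w_osc], and [2 * om n * h <= 16]
    gives the constant. *)
Lemma drift_cell n a h : 0 < h -> om n * h <= 8 ->
  drift n (a + h) - drift n a <= 2 * `|v n (a + h) - v n a| + 16 * kappa * (u n (a + h) - u n a).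
Proof.
move=> h0 oh.
have inside z : `|z - a| <= `|a + h - a| -> 0 <= (z - a) * (a + h - a) -> a <= z <= a + h.
  rewrite addrAC subrr add0r (gtr0_norm h0) pmulr_lge0// => + za.
  by rewrite ger0_norm//; lra.
have [z [z1 z2 ->]] := MVT_any a (a + h) (is_derive_drift n).
have [y [y1 y2 ->]] := MVT_any a (a + h) (is_derive_v n).
have /andP[az zh] := inside _ z1 z2; have /andP[ay yh] := inside _ y1 y2.
have k0 := kappa_gt0; have o := om_gt0 n.
have osc : `|w n z - w n y| <= kappa * om n * (u n (a + h) - u n a).
  have ko : 0 <= kappa * om n by nneg.
  have [zy|yz] := leP z y.
    apply: le_trans (w_osc n zy) _; apply: ler_wpM2l => //.
    by apply: lerB; exact: u_le.
  rewrite distrC; apply: le_trans (w_osc n (ltW yz)) _; apply: ler_wpM2l => //.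
  by apply: lerB; exact: u_le.
rewrite [a + h]addrC addrK in osc *; rewrite normrM (gtr0_norm h0).
have T : drift1 n z <= 2 * `|w n z| := le_trans (drift1_le n z) (bell_le n z).
have tri : `|w n z| <= `|w n y| + kappa * om n * (u n (h + a) - u n a).
  by have := ler_normD (w n z - w n y) (w n y); rewrite subrK; lra.
have U : 0 <= kappa * (u n (h + a) - u n a).
  by apply: mulr_ge0; [exact: ltW|rewrite subr_ge0; apply: u_le; rewrite lerDr ltW].
have := ler_wpM2r (ltW h0) T; have := ler_wpM2r (ltW h0) tri; have := ler_wpM2l U oh.
move: `|w n z| `|w n y| (drift1 n z) (u n (h + a) - u n a) => p q r s.
move: kappa (om n) => k' o'; clear => H1 H2 H3; lra.
Qed.

Lemma grid_variation n : n%:R * (eps ^+ 2 / 64) - 16 * kappa <=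
  2 * \sum_(0 <= j < b ^ n) `|v n (j.+1%:R / b%:R ^+ n) - v n (j%:R / b%:R ^+ n)|.
Proof.
have h0 : 0 < b%:R ^+ n :> R by rewrite exprn_gt0 ?b_gt0.
have hn0 : b%:R ^+ n != 0 :> R by rewrite gt_eqF.
(* The product is [2 * pi]. *)
have oh : om n * (b%:R ^+ n)^-1 <= 8.
  rewrite /om mulfK//; have := @pihalf_lt2 R; lra.
have cell j : drift n (j.+1%:R / b%:R ^+ n) - drift n (j%:R / b%:R ^+ n) <=
    2 * `|v n (j.+1%:R / b%:R ^+ n) - v n (j%:R / b%:R ^+ n)| +
    16 * kappa * (u n (j.+1%:R / b%:R ^+ n) - u n (j%:R / b%:R ^+ n)).
  rewrite (_ : j.+1%:R / _ = j%:R / b%:R ^+ n + (b%:R ^+ n)^-1); last first.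
    by rewrite -natr1 mulrDl mul1r.
  by apply: drift_cell => //; rewrite invr_gt0.
have sums (F : R -> R) : \sum_(0 <= j < b ^ n) (F (j.+1%:R / b%:R ^+ n) - F (j%:R / b%:R ^+ n)) = F 1 - F 0.
  by rewrite (telescope_sumr (fun j => F (j%:R / b%:R ^+ n)))// natrX divff// mul0r.
have : \sum_(0 <= j < b ^ n) (drift n (j.+1%:R / b%:R ^+ n) - drift n (j%:R / b%:R ^+ n)) <=
   \sum_(0 <= j < b ^ n) (2 * `|v n (j.+1%:R / b%:R ^+ n) - v n (j%:R / b%:R ^+ n)| +
    16 * kappa * (u n (j.+1%:R / b%:R ^+ n) - u n (j%:R / b%:R ^+ n))).
  by apply: ler_sum => j _; exact: cell.
have u1 : u n 1 - u n 0 = 1 by rewrite -{1}[1]add0r u_shift addrC addKr.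
by rewrite [X in _ <= X]big_split/= -!mulr_sumr !sums drift_increment u1 mulr1; lra.
Qed.

(** Every later increment has a phase [2 * pi * b^i * j] at such points, where its sine vanishes.
    The variation of [v n] on the grid thus passes unchanged to the limit. *)
Lemma v_grid n m j : (n <= m)%N -> v m (j%:R / b%:R ^+ n) = v n (j%:R / b%:R ^+ n).
Proof.
move=> nm; rewrite -(subnK nm); elim: (m - n)%N => [//|i IH].
rewrite addSn vS IH /Dv (_ : om (i + n) * _ = 0 + om i *+ j).
  by rewrite sin_om sin0 !mulr0 addr0.
have hn0 : b%:R ^+ n != 0 :> R by rewrite gt_eqF// exprn_gt0// b_gt0.
by rewrite /om exprD add0r -[RHS]mulr_natr; field.
Qed.

(** * The extension to the plane *)

(* With [D = Du + i Dv], this is [eta (om y) (D(x) + i y D'(x))]. *)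
Definition gU n (z : R * R) : R := eta (om n * z.2) * (Du n z.1 - z.2 * Dv1 n z.1).
Definition gV n (z : R * R) : R := eta (om n * z.2) * (Dv n z.1 + z.2 * Du1 n z.1).
Definition gUx n (z : R * R) : R := eta (om n * z.2) * (Du1 n z.1 - z.2 * Dv2 n z.1).
Definition gVx n (z : R * R) : R := eta (om n * z.2) * (Dv1 n z.1 + z.2 * Du2 n z.1).
Definition gUy n (z : R * R) : R :=
  om n * eta1 (om n * z.2) * (Du n z.1 - z.2 * Dv1 n z.1) - eta (om n * z.2) * Dv1 n z.1.
Definition gVy n (z : R * R) : R :=
  om n * eta1 (om n * z.2) * (Dv n z.1 + z.2 * Du1 n z.1) + eta (om n * z.2) * Du1 n z.1.

Lemma continuous_derive (f df : R -> R) : (forall x, is_derive x (1 : R) f (df x)) -> continuous f.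
Proof.
move=> D x; apply: differentiable_continuous; apply/derivable1_diffP.
exact: is_derive_derivable (D x).
Qed.

Lemma continuous_fst (f : R -> R) : continuous f -> continuous (fun z : R * R => f z.1).
Proof. by move=> cf z; apply: (@continuous_comp _ _ _ fst f); [exact: cvg_fst|exact: cf]. Qed.

Lemma continuous_snd (f : R -> R) : continuous f -> continuous (fun z : R * R => f z.2).
Proof. by move=> cf z; apply: (@continuous_comp _ _ _ snd f); [exact: cvg_snd|exact: cf]. Qed.

Lemma continuous_scaled (f : R -> R) (a : R) : continuous f -> continuous (fun t => f (a * t)).
Proof.
move=> cf t; apply: (@continuous_comp _ _ _ (fun t => a * t) f); last exact: cf.
by apply: cvgM; [exact: cvg_cst|exact: cvg_id].
Qed.

Lemma g_continuous n :
  [/\ continuous (gU n), continuous (gV n) &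
  [/\ continuous (gUx n), continuous (gVx n), continuous (gUy n) & continuous (gVy n)]].
Proof.
have [du du1 cu2] := Du_derive n; have [dv dv1 cv2] := Dv_derive n.
have cu := continuous_fst (continuous_derive du); have cu1 := continuous_fst (continuous_derive du1).
have cv := continuous_fst (continuous_derive dv); have cv1 := continuous_fst (continuous_derive dv1).
have {}cu2 := continuous_fst cu2; have {}cv2 := continuous_fst cv2.
have ce := continuous_snd (continuous_scaled (a := om n) (@continuous_eta R)).
have ce1 := continuous_snd (continuous_scaled (a := om n) (@continuous_eta1 R)).
have cy : continuous (fun z : R * R => z.2) by move=> z; exact: cvg_snd.
have cM (f g : R * R -> R) : continuous f -> continuous g -> continuous (fun z => f z * g z).
  by move=> cf cg z; apply: cvgM; [exact: cf|exact: cg].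
have cD (f g : R * R -> R) : continuous f -> continuous g -> continuous (fun z => f z + g z).
  by move=> cf cg z; apply: cvgD; [exact: cf|exact: cg].
have cB (f g : R * R -> R) : continuous f -> continuous g -> continuous (fun z => f z - g z).
  by move=> cf cg z; apply: cvgB; [exact: cf|exact: cg].
have co : continuous (fun z : R * R => om n) by move=> z; exact: cvg_cst.
split; [| |split].
- exact: cM ce (cB _ _ cu (cM _ _ cy cv1)).
- exact: cM ce (cD _ _ cv (cM _ _ cy cu1)).
- exact: cM ce (cB _ _ cu1 (cM _ _ cy cv2)).
- exact: cM ce (cD _ _ cv1 (cM _ _ cy cu2)).
- exact: cB (cM _ _ (cM _ _ co ce1) (cB _ _ cu (cM _ _ cy cv1))) (cM _ _ ce cv1).
- exact: cD (cM _ _ (cM _ _ co ce1) (cD _ _ cv (cM _ _ cy cu1))) (cM _ _ ce cu1).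
Qed.

Lemma gU_derive n (x y : R) : is_derive x (1 : R) (fun t => gU n (t, y)) (gUx n (x, y)) /\
  is_derive y (1 : R) (fun t => gU n (x, t)) (gUy n (x, y)).
Proof.
have [du du1 _] := Du_derive n; have [dv dv1 _] := Dv_derive n.
have h := is_deriveCf (eta (om n * y)) (is_deriveBf (du x) (is_deriveCf y (dv1 x))).
split; first exact: h.
have De : is_derive y (1 : R) (fun t => eta (om n * t)) (om n * eta1 (om n * y)).
  by rewrite mulrC; exact: is_derive_compf (is_derive_eta _) (is_derive_linear (om n) y).
have Dl : is_derive y (1 : R) (fun t => Du n x - t * Dv1 n x) (0 - (y * 0 + 1 * Dv1 n x)).
  by apply: is_deriveBf; apply: is_deriveMf.
by apply: is_derive_eq (is_deriveMf De Dl) _; rewrite /gUy/=; ring.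
Qed.

Lemma gV_derive n (x y : R) : is_derive x (1 : R) (fun t => gV n (t, y)) (gVx n (x, y)) /\
  is_derive y (1 : R) (fun t => gV n (x, t)) (gVy n (x, y)).
Proof.
have [du du1 _] := Du_derive n; have [dv dv1 _] := Dv_derive n.
have h := is_deriveCf (eta (om n * y)) (is_deriveDf (dv x) (is_deriveCf y (du1 x))).
split; first exact: h.
have De : is_derive y (1 : R) (fun t => eta (om n * t)) (om n * eta1 (om n * y)).
  by rewrite mulrC; exact: is_derive_compf (is_derive_eta _) (is_derive_linear (om n) y).
have Dl : is_derive y (1 : R) (fun t => Dv n x + t * Du1 n x) (0 + (y * 0 + 1 * Du1 n x)).
  by apply: is_deriveDf; apply: is_deriveMf.
by apply: is_derive_eq (is_deriveMf De Dl) _; rewrite /gVy/=; ring.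
Qed.

Lemma om_ge n : 2 * 8 ^+ n <= om n.
Proof.
have b100 := b_ge100.
rewrite /om; apply: ler_pM => //; first by have := @pi_ge2 R; lra.
by apply: lerXn2r; rewrite ?nnegrE//; lra.
Qed.

Section Terms.
Variables (n : nat) (x y : R).
Let E : R := eta (om n * y).
Let E1 : R := om n * eta1 (om n * y).

Lemma far_or_close : (E = 0 /\ E1 = 0) \/ `|y| <= 2 / om n.
Proof.
have o := om_gt0 n; have [h|h] := lerP 2 `|om n * y|.
  by left; rewrite /E /E1; have [-> ->] := eta_far h; rewrite mulr0.
by right; rewrite ler_pdivlMr// mulrC -(gtr0_norm o) -normrM ltW.
Qed.

(** On the support of the cut-off a factor [y] is worth at most [2 / om n], and differentiating the
    cut-off costs at most [16 * om n]; the powers of [om n] cancel in every product. *)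
Lemma term_bounds :
  [/\ `|E * Du1 n x| <= 2 * eps * d n x, `|E * Dv1 n x| <= 2 * eps * d n x,
      `|E * (y * Du2 n x)| <= 8 * eps * d n x & `|E * (y * Dv2 n x)| <= 8 * eps * d n x] /\
  [/\ `|E1 * Du n x| <= 16 * eps * d n x, `|E1 * Dv n x| <= 16 * eps * d n x,
      `|E1 * (y * Du1 n x)| <= 64 * eps * d n x & `|E1 * (y * Dv1 n x)| <= 64 * eps * d n x].
Proof.
have o := om_gt0 n; have e0 := eps_gt0; have p := d_gt0 n x.
have [hu0 hu1 hu2] := Du_bounds n; have [hv0 hv1 hv2] := Dv_bounds n.
have [/(_ x) hu0' /(_ x) hu1' /(_ x) hu2'] := And3 hu0 hu1 hu2.
have [/(_ x) hv0' /(_ x) hv1' /(_ x) hv2'] := And3 hv0 hv1 hv2.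
have [f0 f1 f2] := eta_bounds (om n * y).
have nE : `|E| <= 1 by rewrite ger0_norm.
have nE1 : `|E1| <= 16 * om n.
  by rewrite /E1 normrM (gtr0_norm o) mulrC; apply: ler_wpM2r => //; exact: ltW.
have eqs (a a' c : R) : a = a' -> `|c| <= a -> `|c| <= a' by move=> ->.
have prod (a a' c c' : R) : `|a| <= a' -> `|c| <= c' -> `|a * c| <= a' * c'.
  by move=> ha hc; rewrite normrM ler_pM.
have [[-> ->]|yb] := far_or_close.
  by split; split; rewrite mul0r normr0; nneg.
split; split.
- by apply: eqs (prod _ _ _ _ nE hu1'); ring.
- by apply: eqs (prod _ _ _ _ nE hv1'); ring.
- by apply: eqs (prod _ _ _ _ nE (prod _ _ _ _ yb hu2')); field; rewrite gt_eqF.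
- by apply: eqs (prod _ _ _ _ nE (prod _ _ _ _ yb hv2')); field; rewrite gt_eqF.
- by apply: eqs (prod _ _ _ _ nE1 hu0'); field; rewrite gt_eqF.
- by apply: eqs (prod _ _ _ _ nE1 hv0'); field; rewrite gt_eqF.
- by apply: eqs (prod _ _ _ _ nE1 (prod _ _ _ _ yb hu1')); field; rewrite gt_eqF.
- by apply: eqs (prod _ _ _ _ nE1 (prod _ _ _ _ yb hv1')); field; rewrite gt_eqF.
Qed.

End Terms.

(** The amplitudes are summable because [om n >= 2 * 8^n] beats [d n <= 2^n]. For the derivatives
    the constants total at most [16 + 64 + 2], below 200, so [eps] brings them under [d n]. *)
Lemma g_bounds n z :
  [/\ `|gU n z| <= 2^-1 ^+ n, `|gV n z| <= 2^-1 ^+ n &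
  [/\ `|gUx n z| <= 2 ^+ n * (`|z.2| <= 2 / om n)%R%:R,
      `|gVx n z| <= 2 ^+ n * (`|z.2| <= 2 / om n)%R%:R,
      `|gUy n z| <= 2 ^+ n * (`|z.2| <= 2 / om n)%R%:R &
      `|gVy n z| <= 2 ^+ n * (`|z.2| <= 2 / om n)%R%:R]].
Proof.
have e0 := eps_gt0; have e1 := eps_small.
have gen_ed (D T : R) : 0 <= D -> D <= T -> 200 * (eps * D) <= T.
  by move=> D0 DT; have := ler_wpM2r D0 e1; lra.
have gen_small (D T t : R) : 0 <= D -> 200 * (eps * D) <= T -> 1 <= T -> t = 2 * (T * T) -> 5 * eps * D <= t.
  by move=> D0 h T1 ->; have := ler_wpM2r (le_trans ler01 T1) T1; lra.
have gen2 (D T A B c c' : R) : 0 <= D -> 200 * (eps * D) <= T ->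
    `|A| <= c * eps * D -> `|B| <= c' * eps * D -> c + c' <= 200 -> `|A - B| <= T /\ `|A + B| <= T.
  move=> D0 hT hA hB hc; have h := ler_wpM2r (mulr_ge0 (ltW e0) D0) hc.
  by have := ler_normB A B; have := ler_normD A B; lra.
have gen3 (D T A B C c c' c'' : R) : 0 <= D -> 200 * (eps * D) <= T ->
    `|A| <= c * eps * D -> `|B| <= c' * eps * D -> `|C| <= c'' * eps * D -> c + c' + c'' <= 200 ->
    `|A - B - C| <= T /\ `|A + B + C| <= T.
  move=> D0 hT hA hB hC hc; have h := ler_wpM2r (mulr_ge0 (ltW e0) D0) hc.
  have := ler_normB (A - B) C; have := ler_normB A B.
  by have := ler_normD (A + B) C; have := ler_normD A B; lra.
have prod (E A : R) (a c : R) : `|E| <= 1 -> `|A| <= a -> a <= c -> `|E * A| <= c.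
  by move=> h1 h2 h3; apply: le_trans h3; rewrite normrM -[a]mul1r; apply: ler_pM.
have n1 : 2 + 8 <= 200 :> R by lra.
have n2 : 16 + 64 + 2 <= 200 :> R by lra.
have n3 : 2^-1 * 8 = 2 * 2 :> R by lra.
have sum5 (o D : R) : eps / o * D + 4 * eps / o * D = 5 * eps / o * D by ring.
have o := om_gt0 n; case: z => x y; have p := d_gt0 n x.
have [[a1 a2 a3 a4] [b1 b2 b3 b4]] := term_bounds n x y.
have ed := gen_ed _ _ (ltW p) (d_le_pow2 n x).
have [hu0 hu1 _] := Du_bounds n; have [hv0 hv1 _] := Dv_bounds n.
have small : 5 * eps / om n * d n x <= 2^-1 ^+ n.
  rewrite mulrAC ler_pdivrMr//.
  apply: (@le_trans _ _ (2^-1 ^+ n * (2 * 8 ^+ n))); last first.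
    by apply: ler_wpM2l; [exact: exprn_ge0|exact: om_ge].
  apply: (gen_small _ _ _ (ltW p) ed); first by rewrite exprn_ege1// ler1n.
  by rewrite mulrCA -exprMn n3 exprMn.
have nE : `|eta (om n * y)| <= 1.
  by have [f0 f1 _] := eta_bounds (om n * y); rewrite ger0_norm.
rewrite /gU /gV /gUx /gVx /gUy /gVy /=.
have [[E0 E1]|yb] := far_or_close n y.
  rewrite E0 E1 !mul0r subr0 addr0 normr0.
  by split; [exact: exprn_ge0|exact: exprn_ge0|split; apply: mulr_ge0; rewrite ?exprn_ge0// ler0n].
have yD (A : R) : `|A| <= 2 * eps * d n x -> `|y * A| <= 4 * eps / om n * d n x.
  move=> hA; rewrite normrM; apply: le_trans (ler_pM (normr_ge0 y) (normr_ge0 A) yb hA) _.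
  by rewrite le_eqVlt; apply/orP; left; apply/eqP; field; rewrite gt_eqF.
rewrite yb !mulr1; split.
- apply: (prod _ _ _ _ nE _ small); apply: le_trans (ler_normB _ _) _.
  by apply: le_trans (lerD (hu0 x) (yD _ (hv1 x))) _; rewrite sum5.
- apply: (prod _ _ _ _ nE _ small); apply: le_trans (ler_normD _ _) _.
  by apply: le_trans (lerD (hv0 x) (yD _ (hu1 x))) _; rewrite sum5.
rewrite !mulrBr !mulrDr; split.
- exact: (gen2 _ _ _ _ _ _ (ltW p) ed a1 a4 n1).1.
- exact: (gen2 _ _ _ _ _ _ (ltW p) ed a2 a3 n1).2.
- exact: (gen3 _ _ _ _ _ _ _ _ (ltW p) ed b1 b4 a2 n2).1.
- exact: (gen3 _ _ _ _ _ _ _ _ (ltW p) ed b2 b3 a1 n2).2.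
Qed.

Lemma rate_bounds n : 0 <= 2 / om n /\ 2 / om n <= 8^-1 ^+ n.
Proof.
have o := om_gt0 n; split; first by nneg.
rewrite ler_pdivrMr//; apply: (@le_trans _ _ (8^-1 ^+ n * (2 * 8 ^+ n))).
  by rewrite mulrCA -exprMn mulVf// expr1n mulr1.
by apply: ler_wpM2l => //; exact: om_ge.
Qed.

(** * The limit map, its weak derivatives and the Beltrami inequality *)

Definition fst_fun (z : R * R) : R := z.1.
Definition snd_fun (z : R * R) : R := z.2.

Lemma continuous_fst_fun : continuous fst_fun.
Proof. by move=> z; exact: cvg_fst. Qed.

Lemma continuous_snd_fun : continuous snd_fun.
Proof. by move=> z; exact: cvg_snd. Qed.

Lemma continuous_cst_fun (c : R) : continuous (cst c : R * R -> R).
Proof. by move=> z; exact: cvg_cst. Qed.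

Lemma is_derive_psum1 (f f' : R * R -> R) (F F' : nat -> R * R -> R) N (x y : R) :
  is_derive x (1 : R) (fun t => f (t, y)) (f' (x, y)) ->
  (forall n, is_derive x (1 : R) (fun t => F n (t, y)) (F' n (x, y))) ->
  is_derive x (1 : R) (fun t => psum f F N (t, y)) (psum f' F' N (x, y)).
Proof.
move=> h hF; apply: is_deriveDf => //.
by apply: (@is_derive_sumf _ N (fun n t => F n (t, y)) (fun n t => F' n (t, y))).
Qed.

Lemma is_derive_psum2 (f f' : R * R -> R) (F F' : nat -> R * R -> R) N (x y : R) :
  is_derive y (1 : R) (fun t => f (x, t)) (f' (x, y)) ->
  (forall n, is_derive y (1 : R) (fun t => F n (x, t)) (F' n (x, y))) ->
  is_derive y (1 : R) (fun t => psum f F N (x, t)) (psum f' F' N (x, y)).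
Proof.
move=> h hF; apply: is_deriveDf => //.
by apply: (@is_derive_sumf _ N (fun n t => F n (x, t)) (fun n t => F' n (x, t))).
Qed.

Let r n : R := 2 / om n.
Definition U := series_fun fst_fun gU.
Definition V := series_fun snd_fun gV.
Definition Ux := series_deriv (cst 1) gUx.
Definition Uy := series_deriv (cst 0) gUy.
Definition Vx := series_deriv (cst 0) gVx.
Definition Vy := series_deriv (cst 1) gVy.

Let cgU n : continuous (gU n). Proof. by have [] := g_continuous n. Qed.
Let cgV n : continuous (gV n). Proof. by have [] := g_continuous n. Qed.
Let cgUx n : continuous (gUx n). Proof. by have [_ _ []] := g_continuous n. Qed.
Let cgVx n : continuous (gVx n). Proof. by have [_ _ []] := g_continuous n. Qed.
Let cgUy n : continuous (gUy n). Proof. by have [_ _ []] := g_continuous n. Qed.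
Let cgVy n : continuous (gVy n). Proof. by have [_ _ []] := g_continuous n. Qed.

Let bgU n z : `|gU n z| <= 2^-1 ^+ n. Proof. by have [] := g_bounds n z. Qed.
Let bgV n z : `|gV n z| <= 2^-1 ^+ n. Proof. by have [] := g_bounds n z. Qed.
Let bgUx n z : `|gUx n z| <= 2 ^+ n * (`|z.2| <= r n)%R%:R. Proof. by have [_ _ []] := g_bounds n z. Qed.
Let bgVx n z : `|gVx n z| <= 2 ^+ n * (`|z.2| <= r n)%R%:R. Proof. by have [_ _ []] := g_bounds n z. Qed.
Let bgUy n z : `|gUy n z| <= 2 ^+ n * (`|z.2| <= r n)%R%:R. Proof. by have [_ _ []] := g_bounds n z. Qed.
Let bgVy n z : `|gVy n z| <= 2 ^+ n * (`|z.2| <= r n)%R%:R. Proof. by have [_ _ []] := g_bounds n z. Qed.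

Let r0 n : 0 <= r n. Proof. by have [] := rate_bounds n. Qed.
Let r1 n : r n <= 8^-1 ^+ n. Proof. by have [] := rate_bounds n. Qed.

Let b_fst z : `|fst_fun z| <= `|z.1| + `|z.2|. Proof. by rewrite lerDl. Qed.
Let b_snd z : `|snd_fun z| <= `|z.1| + `|z.2|. Proof. by rewrite lerDr. Qed.
Let b_one (z : R * R) : `|cst (1 : R) z| <= 1. Proof. by rewrite normr1. Qed.
Let b_zero (z : R * R) : `|cst (0 : R) z| <= 1. Proof. by rewrite normr0. Qed.

Let cst_c (c : R) : continuous (cst c : R * R -> R). Proof. exact: continuous_cst_fun. Qed.

Let cF : continuous fst_fun := continuous_fst_fun.
Let cS : continuous snd_fun := continuous_snd_fun.

Lemma weak_psum N :
  [/\ weak_deriv (ex R) (psum fst_fun gU N) (psum (cst 1) gUx N),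
      weak_deriv (ey R) (psum fst_fun gU N) (psum (cst 0) gUy N),
      weak_deriv (ex R) (psum snd_fun gV N) (psum (cst 0) gVx N) &
      weak_deriv (ey R) (psum snd_fun gV N) (psum (cst 1) gVy N)].
Proof.
split.
- apply: (@weak_deriv_ex_C1 R (psum fst_fun gU N) (psum (cst 1) gUx N)) => [||x y].
  + exact: continuous_psum.
  + exact: continuous_psum.
  by apply: is_derive_psum1 => n; have [] := gU_derive n x y.
- apply: (@weak_deriv_ey_C1 R (psum fst_fun gU N) (psum (cst 0) gUy N)) => [||x y].
  + exact: continuous_psum.
  + exact: continuous_psum.
  apply: is_derive_psum2 => [|n]; first exact: is_derive_cst.
  by have [] := gU_derive n x y.
- apply: (@weak_deriv_ex_C1 R (psum snd_fun gV N) (psum (cst 0) gVx N)) => [||x y].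
  + exact: continuous_psum.
  + exact: continuous_psum.
  apply: is_derive_psum1 => [|n]; first exact: is_derive_cst.
  by have [] := gV_derive n x y.
- apply: (@weak_deriv_ey_C1 R (psum snd_fun gV N) (psum (cst 1) gVy N)) => [||x y].
  + exact: continuous_psum.
  + exact: continuous_psum.
  by apply: is_derive_psum2 => n; have [] := gV_derive n x y.
Qed.

Lemma continuous_U : continuous U.
Proof. exact: continuous_series_fun. Qed.

Lemma continuous_V : continuous V.
Proof. exact: continuous_series_fun. Qed.

Lemma W12loc_UV : W12loc_with (fun z => (U z, V z)) Ux Uy Vx Vy.
Proof.
split; [exact: L2loc_continuous continuous_U|exact: L2loc_continuous continuous_V| |]; split.
- exact: (L2loc_series_deriv (r := r)).
- exact: (L2loc_series_deriv (r := r)).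
- exact: (L2loc_series_deriv (r := r)).
- exact: (L2loc_series_deriv (r := r)).
- by apply: (weak_deriv_series (r := r)) => // N; have [] := weak_psum N.
- by apply: (weak_deriv_series (r := r)) => // N; have [] := weak_psum N.
- by apply: (weak_deriv_series (r := r)) => // N; have [] := weak_psum N.
- by apply: (weak_deriv_series (r := r)) => // N; have [] := weak_psum N.
Qed.

(** While no cut-off is felt, the partial sum is [F_m(x) + i y F_m'(x)], the first-order expansion
    of a holomorphic extension of [F_m = u_m + i v_m]; it fails to be holomorphic only through
    [y F_m''(x)]. *)
Lemma psum_near m (x y : R) : (forall n, (n < m)%N -> `|om n * y| <= 1) ->
  [/\ psum (cst 1) gUx m (x, y) = d m x - y * w1 m x,
      psum (cst 0) gUy m (x, y) = - w m x,
      psum (cst 0) gVx m (x, y) = w m x + y * d1 m x &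
      psum (cst 1) gVy m (x, y) = d m x].
Proof.
elim: m => [|m IH] h.
  by rewrite !psum0 d0 w10 w0 d10 mulr0 subr0 addr0 oppr0.
have [e1 e2 e3 e4] := IH (fun n nm => h n (ltnW nm)).
have [E0 E1] := eta_near (h m (ltnSn m)).
rewrite !psumS e1 e2 e3 e4 /gUx /gUy /gVx /gVy/= E0 E1 dS wS d1S w1S.
by split; ring.
Qed.

Lemma om_le n m : (n <= m)%N -> om n <= om m.
Proof.
move=> /subnK <-; elim: (m - n)%N => [//|k IH].
rewrite addSn omS; apply: le_trans IH _; rewrite ler_peMl//; first exact/ltW/om_gt0.
by have := b_ge100; lra.
Qed.

(** Take the least [m] with [|om m * y| > 1]. From the next level on, the factor [b >= 100] pushes
    [|om n * y|] beyond 2, outside the support of the cut-off. *)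
Lemma critical_level y : y != 0 -> exists m, [/\ 1 < `|om m * y|,
  forall n, (n < m)%N -> `|om n * y| <= 1 & forall n, (m < n)%N -> 2 / om n < `|y|].
Proof.
rewrite -normr_gt0 => y0.
have ex : exists n, 1 < `|om n * y|.
  have [M hM] := r_lt r1 y0; exists M; have := hM M (leqnn M).
  have o := om_gt0 M; rewrite /r ltr_pdivrMr// normrM (gtr0_norm o) mulrC.
  by apply: le_lt_trans; lra.
case: (ex_minnP ex) => m hm min; exists m; split => // n nm.
  by rewrite leNgt; apply/negP => /min; rewrite leqNgt nm.
have o := om_gt0 n; have o' := om_gt0 m; rewrite ltr_pdivrMr//.
have : om m.+1 <= om n by exact: om_le.
rewrite omS => h; rewrite mulrC; apply: lt_le_trans (ler_wpM2r (ltW y0) h).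
move: hm; rewrite normrM (gtr0_norm o') -[b%:R * _ * _]mulrA => hm.
by have := ler_wpM2r (le_trans ler01 (ltW hm)) b_ge100; lra.
Qed.

(** Level [m - 1] is still uncut, so [|y| <= 1 / om (m - 1)], while
    [kappa * om m = 8 * eps * om (m - 1)]. At level 0 both second derivatives vanish. *)
Lemma low_frequency_bound m (x y : R) : (forall n, (n < m)%N -> `|om n * y| <= 1) ->
  `|y * w1 m x| <= 8 * eps * d m x /\ `|y * d1 m x| <= 8 * eps * d m x.
Proof.
have e0 := eps_gt0; have p := d_gt0 m x.
case: m p => [|m] p h; first by rewrite w10 d10 mulr0 normr0; split; nneg.
have o := om_gt0 m; have := h m (ltnSn m).
rewrite normrM (gtr0_norm o) => oy.
have aux A : `|A| <= kappa * om m.+1 * d m.+1 x -> `|y * A| <= 8 * eps * d m.+1 x.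
  rewrite omS mulrA kappa_b => hA; rewrite normrM.
  apply: le_trans (ler_wpM2l (normr_ge0 y) hA) _.
  rewrite (_ : `|y| * _ = 8 * eps * d m.+1 x * (om m * `|y|)); last by ring.
  by rewrite -[leRHS]mulr1; apply: ler_wpM2l => //; nneg.
by split; apply: aux; [exact: w1_bound|exact: d1_bound].
Qed.

Lemma sqrt_sumsq_le (A B : R) : Num.sqrt (A ^+ 2 + B ^+ 2) <= `|A| + `|B|.
Proof.
have h : 0 <= `|A| + `|B| by apply: addr_ge0.
rewrite -[leRHS](ger0_norm h) -sqrtr_sqr; apply: ler_wsqrtr.
rewrite -[A ^+ 2]real_normK ?num_real// -[B ^+ 2]real_normK ?num_real//.
by have := mulr_ge0 (normr_ge0 A) (normr_ge0 B); rewrite !expr2; lra.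
Qed.

(** The possibly large [W] cancels in [V_x + U_y]. Each component of [f_zbar] collects
    [8 + 8 + 16 + 64 = 96] units of [eps * D], together less than [D], whereas [U_x + V_y] loses at
    most 100 such units from [2 * D], leaving at least [3 / 2 * D]. *)
Lemma cone_arith (D W p1 p2 a1 a2 a3 a4 c1 c2 c3 c4 : R) : 0 < D ->
  `|p1| <= 8 * eps * D -> `|p2| <= 8 * eps * D ->
  `|a1| <= 2 * eps * D -> `|a3| <= 8 * eps * D -> `|a4| <= 8 * eps * D ->
  `|c1| <= 16 * eps * D -> `|c2| <= 16 * eps * D -> `|c3| <= 64 * eps * D -> `|c4| <= 64 * eps * D ->
  Num.sqrt (((D - p1 + (a1 - a4)) - (D + (c2 + c3 + a1))) ^+ 2 +
            ((W + p2 + (a2 + a3)) + (- W + (c1 - c4 - a2))) ^+ 2) / 2 <=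
  3 / 4 * (((D - p1 + (a1 - a4)) + (D + (c2 + c3 + a1))) / 2).
Proof.
move=> D0 hp1 hp2 ha1 ha3 ha4 hc1 hc2 hc3 hc4.
have eD : 200 * (eps * D) <= D by have := ler_wpM2r (ltW D0) eps_small; lra.
rewrite mulrA; apply: ler_wpM2r => //; apply: le_trans (sqrt_sumsq_le _ _) _.
have -> : (D - p1 + (a1 - a4)) - (D + (c2 + c3 + a1)) = - (p1 + a4 + c2 + c3) by ring.
have -> : (W + p2 + (a2 + a3)) + (- W + (c1 - c4 - a2)) = p2 + a3 + c1 - c4 by ring.
rewrite normrN.
have h1 : `|p1 + a4 + c2 + c3| <= 96 * (eps * D).
  have := ler_normD (p1 + a4 + c2) c3; have := ler_normD (p1 + a4) c2; have := ler_normD p1 a4; lra.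
have h2 : `|p2 + a3 + c1 - c4| <= 96 * (eps * D).
  have := ler_normB (p2 + a3 + c1) c4; have := ler_normD (p2 + a3) c1; have := ler_normD p2 a3; lra.
move: hp1 ha1 ha4 hc2 hc3; rewrite !ler_norml => /andP[_ ?] /andP[? _] /andP[_ ?] /andP[? _] /andP[? _].
lra.
Qed.

Lemma cone_UV z : z.2 != 0 ->
  abs_fzbar Ux Uy Vx Vy z <= 3 / 4 * re_fz Ux Uy Vx Vy z.
Proof.
case: z => x y /= y0; have [m [_ low high]] := critical_level y0.
have [e1 e2 e3 e4] := psum_near x low.
(* Terms beyond the critical level vanish at this height, so each series is its uncut partial sum
   plus the single term [m]. *)
have val g0 G' : (forall n z, `|G' n z| <= 2 ^+ n * (`|z.2| <= r n)%R%:R) ->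
    series_deriv g0 G' (x, y) = psum g0 G' m (x, y) + G' m (x, y).
  by move=> bG; rewrite -psumS (@series_derivE _ _ _ r r0 bG _ m.+1 m.+1).
have [[a1 a2 a3 a4] [c1 c2 c3 c4]] := term_bounds m x y.
have [p1 p2] := low_frequency_bound x low.
rewrite /abs_fzbar /re_fz /Ux /Uy /Vx /Vy !val// e1 e2 e3 e4.
rewrite /gUx /gUy /gVx /gVy/= !mulrBr !mulrDr.
exact: cone_arith (d_gt0 m x) p1 p2 a1 a3 a4 c1 c2 c3 c4.
Qed.

(** Far from the axis all cut-offs vanish; this exhibits two points with different images, as
    nonconstancy requires. *)
Lemma UV_far x y : 2 <= `|y| -> U (x, y) = x /\ V (x, y) = y.
Proof.
move=> y2; have far n : eta (om n * y) = 0.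
  have o := om_ge n; have o0 := om_gt0 n.
  have [] // := @eta_far R (om n * y); rewrite normrM (gtr0_norm o0).
  have : 1 <= om n.
    by apply: le_trans o; have : 1 <= 8 ^+ n :> R by [rewrite exprn_ege1// ler1n]; lra.
  by move=> h; have := ler_pM ler01 (ler0n R 2) h y2; rewrite mul1r.
have aux g0 G : (forall n, G n (x, y) = 0) -> series_fun g0 G (x, y) = g0 (x, y).
  move=> G0; apply/lim_near_cst => //; apply: nearW => N.
  by rewrite /psum big1 ?addr0.
by split; apply: aux => n; rewrite /gU /gV /= far mul0r.
Qed.

Lemma reduced_qc_UV : reduced_qc (fun z => (U z, V z)).
Proof.
split.
  exists (0, 2), (1, 2).
  have h x := @UV_far x 2; have [-> ->] := h 0 (ler_norm 2); have [-> ->] := h 1 (ler_norm 2).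
  by case=> /eqP; rewrite eq_sym oner_eq0.
split; first by move=> z; exact: (cvg_pair (@continuous_U z) (@continuous_V z)).
exists Ux, Uy, Vx, Vy; split; first exact: W12loc_UV.
exists (3 / 4); split; first by apply/andP; split; lra.
by apply: negligibleS (@axis_negligible R) => z /= h; apply: contrapT => /eqP /cone_UV.
Qed.

Lemma V_axis n j : V (j%:R / b%:R ^+ n, 0) = v n (j%:R / b%:R ^+ n).
Proof.
set x := j%:R / b%:R ^+ n.
have E N : psum snd_fun gV N (x, 0) = v N x.
  elim: N => [|N IH]; first by rewrite psum0.
  rewrite psumS IH vS /gV/= mulr0 mul0r addr0.
  by have [|-> _] := @eta_near R 0; [rewrite normr0|rewrite mul1r].
apply/lim_near_cst => //; exists n => // m /= nm; rewrite E; exact: v_grid.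
Qed.

Lemma V_variation n : n%:R * (eps ^+ 2 / 128) - 8 * kappa <=
  \sum_(0 <= j < b ^ n) `|V (j.+1%:R / b%:R ^+ n, 0) - V (j%:R / b%:R ^+ n, 0)|.
Proof.
under eq_bigr do rewrite !V_axis.
by have := grid_variation n; lra.
Qed.

End Line.

(** * Infinite variation *)

Section Variation.
Variable R : realType.
Implicit Types (Phi : R -> R) (q : R).

Lemma jensen_mean Phi (t : nat -> R) N : (0 < N)%N ->
  (forall s t l, 0 <= s -> 0 <= t -> 0 <= l <= 1 ->
     Phi (l * s + (1 - l) * t) <= l * Phi s + (1 - l) * Phi t) ->
  (forall j, 0 <= t j) ->
  N%:R * Phi ((\sum_(0 <= j < N) t j) / N%:R) <= \sum_(0 <= j < N) Phi (t j).
Proof.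
case: N => // N _ cvx t0; elim: N => [|N IH]; first by rewrite !big_nat1 divr1 mul1r.
rewrite [X in Phi (X / _)]big_nat_recr//= [X in _ <= X]big_nat_recr//=.
set S := \sum_(0 <= j < N.+1) t j in IH *.
have N1 : 0 < N.+1%:R :> R by rewrite ltr0n.
have N2 : 0 < N.+2%:R :> R by rewrite ltr0n.
have N12 : N.+2%:R = N.+1%:R + 1 :> R by rewrite -natr1.
have S0 : 0 <= S by apply: sumr_ge0.
pose l : R := N.+1%:R / N.+2%:R.
have l1 : 1 - l = 1 / N.+2%:R by apply: (mulIf (lt0r_neq0 N2)); rewrite /l mulrBl !divfK ?gt_eqF// mul1r N12; ring.
have := cvx (S / N.+1%:R) (t N.+1) l (divr_ge0 S0 (ltW N1)) (t0 _).
have -> : l * (S / N.+1%:R) + (1 - l) * t N.+1 = (S + t N.+1) / N.+2%:R.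
  by rewrite l1 /l; field; rewrite !gt_eqF.
rewrite l1 /l => h; apply: (@le_trans _ _ (N.+1%:R * Phi (S / N.+1%:R) + Phi (t N.+1))); last by rewrite lerD2r.
have {}h := h _.
rewrite -ler_pdivlMl//; apply: le_trans (h _) _.
  apply/andP; split; first by rewrite divr_ge0 ?ler0n.
  by rewrite ler_pdivrMr// mul1r N12 lerDl.
by rewrite le_eqVlt; apply/orP; left; apply/eqP; field; rewrite gt_eqF.
Qed.

Lemma cmod_ge (z w : R * R) : `|z.2 - w.2| <= cmod (cdiff z w).
Proof.
by rewrite /cmod/= -sqrtr_sqr; apply: ler_wsqrtr; rewrite lerDr sqr_ge0.
Qed.

(** After division by [x^q] the claim is [M < c * x^(1 - q)], which holds beyond the power
    [1 / (1 - q)] of any number exceeding [|M| / c]. *)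
Lemma powR_dominates q (c M : R) : 0 < q < 1 -> 0 < c ->
  exists x0 : R, forall x, x0 < x -> 0 < x /\ M * x `^ q < c * x.
Proof.
move=> /andP[q0 q1] c0; pose M1 : R := `|M| / c + 1.
have M10 : 0 < M1 by rewrite ltr_wpDl// divr_ge0// ltW.
exists (M1 `^ (1 - q)^-1) => x hx.
have x0 : 0 < x by apply: le_lt_trans hx; exact: powR_ge0.
split => //; have xq : 0 < x `^ q by exact: powR_gt0.
have E : x = x `^ q * x `^ (1 - q).
  have e : q + (1 - q) = 1 by ring.
  by rewrite -powRD ?e ?powRr1 ?ltW// (gt_eqF x0) implybT.
have h : M1 < x `^ (1 - q).
  have q2 : 0 < 1 - q by lra.
  have := gt0_ltr_powR q2 _ _ hx; rewrite -powRrM mulVf ?gt_eqF// powRr1 ?ltW//.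
  by apply; rewrite nnegrE ?powR_ge0// ltW.
rewrite [in ltRHS]E mulrCA [M * _]mulrC ltr_pM2l//.
apply: le_lt_trans (ler_norm M) _.
have : `|M| < c * M1 by rewrite /M1 mulrDr mulrCA divff ?gt_eqF// mulr1 mulr1 ltrDl.
by move=> hM; apply: lt_trans hM _; rewrite ltr_pM2l.
Qed.

(** For large [n] the mean [L n / b^n] is at least [t = (a / 2) * n / b^n], and
    [ln (1 / t) <= n * ln b]; the quantity is then at least a multiple of [n^(1 - q)]. *)
Lemma phi_variation_unbounded q Phi (b : nat) (a k : R) (L : nat -> R) (M : R) :
  0 < q < 1 -> Phi_q q Phi -> (4 <= b)%N -> 0 < a ->
  (forall n, n%:R * a - k <= L n) ->
  exists n, M < (b ^ n)%:R * Phi (L n / (b ^ n)%:R).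
Proof.
move=> hq [Phi0 Phimono cvx [delta [delta0 PhiE]]] b4 a0 hL.
have b1 : 1 < b%:R :> R by rewrite ltr1n (leq_trans _ b4).
have B0 : 0 < ln (b%:R : R) by apply: ln_gt0.
set B := ln (b%:R : R) in B0.
have [x0 hx] := @powR_dominates q (a / 2 / B) M hq (divr_gt0 (divr_gt0 a0 (ltr0n _ 2)) B0).
(* One summand per demand on [n]: [n * ln b > x0] for [powR_dominates], [|k| <= n * a / 2] to keep
   half of the linear growth, [a / 2 * n >= 1] for [1 / t <= b^n], and the last two for [t < delta]
   and [t < 1]. *)
pose K : R := `|x0| / B + 2 * `|k| / a + 2 / a + a / delta + a.
pose n := (Num.truncn K).+1.
have Kn : K < n%:R by rewrite truncnS_gt.
have K1 : [/\ 0 <= `|x0| / B, 0 <= 2 * `|k| / a, 0 <= 2 / a & 0 <= a / delta].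
  by split; apply: divr_ge0; rewrite ?mulr_ge0// ltW.
case: K1 => k1 k2 k3 k4.
have n0 : 0 < n%:R :> R by rewrite ltr0n.
have x0n : x0 < n%:R * B.
  apply: le_lt_trans (ler_norm x0) _; rewrite -ltr_pdivrMr//.
  by apply: le_lt_trans Kn; rewrite /K; lra.
have kn : `|k| <= n%:R * (a / 2).
  have : 2 * `|k| / a <= n%:R by rewrite /K in Kn; lra.
  by rewrite ler_pdivrMr//; lra.
have half : a / 2 < a by lra.
have ank : a / 2 * n%:R <= n%:R * a - k by have := ler_norm k; lra.
have an1 : 1 <= a / 2 * n%:R.
  have : 2 / a <= n%:R by rewrite /K in Kn; lra.
  by rewrite ler_pdivrMr//; lra.
have an : a / delta < n%:R /\ a < n%:R by rewrite /K in Kn; lra.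
case: an => adelta an.
exists n; set N : R := (b ^ n)%:R.
(* From [n^2 <= (2^n)^2 = 4^n <= b^n] comes [t * n <= a / 2], hence [t] tends to 0 with an explicit
   rate. *)
have N4 : n%:R * n%:R <= N.
  rewrite /N -natrM ler_nat; apply: (@leq_trans (4 ^ n)); last by rewrite leq_exp2r.
  by rewrite (_ : 4 = 2 * 2)%N// expnMn leq_mul// ltnW// ltn_expl.
have N0 : 0 < N by apply: lt_le_trans N4; exact: mulr_gt0.
pose t : R := a / 2 * n%:R / N.
have t0 : 0 < t by rewrite !divr_gt0// mulr_gt0// divr_gt0.
have tn : t * n%:R <= a / 2.
  rewrite /t mulrAC ler_pdivrMr// -[a / 2 * _ * _]mulrA; apply: ler_wpM2l => //.
  by rewrite divr_ge0// ltW.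
have tdelta : t < delta.
  rewrite -(ltr_pM2r n0); apply: le_lt_trans tn _.
  by apply: lt_trans half _; rewrite mulrC -ltr_pdivrMr.
have t1 : t < 1 by rewrite -(ltr_pM2r n0); apply: le_lt_trans tn _; rewrite mul1r (lt_trans half).
have tL : t <= L n / N.
  apply: ler_wpM2r; first by rewrite invr_ge0 ltW.
  exact: le_trans (hL n).
have PhiL : Phi t <= Phi (L n / N).
  by move: tL; rewrite le_eqVlt => /orP[/eqP ->//|h]; apply/ltW/Phimono => //; exact: ltW.
apply: lt_le_trans (ler_wpM2l (ltW N0) PhiL); rewrite PhiE ?t0//.
have tV : 1 < t^-1 by rewrite invf_gt1.
have lnt : 0 < ln t^-1 by exact: ln_gt0.
have lnN : ln t^-1 <= n%:R * B.
  rewrite /B mulr_natl -lnXn ?(lt_trans _ b1)// -natrX -/N ler_ln ?posrE// ?invr_gt0//.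
  rewrite -[N]invrK lef_pV2 ?posrE ?invr_gt0// /t.
  by rewrite -[leLHS]mul1r; apply: ler_wpM2r => //; rewrite invr_ge0 ltW.
have [nB0 hM] := hx _ x0n.
have p0 : 0 < ln t^-1 `^ q by exact: powR_gt0.
have mono : ln t^-1 `^ q <= (n%:R * B) `^ q.
  have /andP[q0 _] := hq.
  by apply: ge0_ler_powR => //; rewrite ?nnegrE ltW.
rewrite mulrA ltr_pdivlMr//.
have -> : N * t = a / 2 * n%:R by rewrite /t mulrC divfK// gt_eqF.
have [M0|M0] := leP 0 M.
  apply: le_lt_trans (ler_wpM2l M0 mono) _; apply: lt_le_trans hM _.
  by rewrite le_eqVlt; apply/orP; left; apply/eqP; field; rewrite gt_eqF.
apply: (@lt_trans _ _ 0); first by rewrite nmulr_rlt0.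
by rewrite mulr_gt0// divr_gt0.
Qed.

End Variation.

Lemma admissible_exists (R : realType) : exists (b : nat) (eps : R), admissible b eps.
Proof.
exists (64 * 64)%N, (1 / 200).
by split; rewrite ?natrM//; lra.
Qed.

Lemma b_ge4 (R : realType) (b : nat) (eps : R) : admissible b eps -> (4 <= b)%N.
Proof.
by move=> adm; rewrite -(ler_nat R); have := b_ge100 adm; lra.
Qed.

Theorem theorem1p3 (R : realType) :
  exists f : R * R -> R * R,
    reduced_qc f /\
    forall q : R, 0 < q < 1 ->
      forall Phi : R -> R, Phi_q q Phi ->
        infinite_Phi_variation01 Phi (fun t => f (t, 0)).
Proof.
have [b [eps adm]] := admissible_exists R.
exists (fun z => (U b eps z, V b eps z)); split; first exact: reduced_qc_UV.
move=> q hq Phi hPhi M.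
have a0 : 0 < eps ^+ 2 / 128 by rewrite divr_gt0// exprn_gt0// (eps_gt0 adm).
have b4 := b_ge4 adm.
have [n hn] := phi_variation_unbounded M hq hPhi b4 a0 (V_variation adm).
have [Phi0 Phimono cvx _] := hPhi.
exists (b ^ n)%N, (fun j => j%:R / b%:R ^+ n).
have bn0 : 0 < b%:R ^+ n :> R by rewrite exprn_gt0// (b_gt0 adm).
split.
  split; first by rewrite expn_gt0 (leq_trans _ b4).
  split; first by rewrite mul0r.
  split; first by rewrite natrX divff// gt_eqF.
  by move=> j _; rewrite ltr_pM2r ?invr_gt0// ltr_nat.
apply: lt_le_trans hn _.
have Nn : (0 < b ^ n)%N by rewrite expn_gt0 (leq_trans _ b4).
(* Jensen is applied to the increments of [V] alone; they are bounded by those of the map, and [Phi]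
   is increasing. *)
apply: le_trans (jensen_mean Nn cvx _) _ => [j|]; first exact: normr_ge0.
rewrite /Phi_sum; apply: ler_sum => j _.
set x := cmod _; have h : `|V b eps (j.+1%:R / b%:R ^+ n, 0) - V b eps (j%:R / b%:R ^+ n, 0)| <= x.
  exact: (cmod_ge (_, _) (_, _)).
by move: h; rewrite le_eqVlt => /orP[/eqP ->//|h]; apply/ltW/Phimono.
Qed.
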